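(* Let $d,n\in\mathbb{N}$ with $d\ge 50$. Then: (1) if $2d\mid n$, then $m(n,2^{d-1}-d)=\frac{2^d-d-\frac12}{d}\,n$, and hence $m(2^{d-1}-d)=\frac{2^d-d-\frac12}{d}$; (2) for every $1\le c\le d-1$, if $d\mid n$, then $m(n,2^{d-1}-c)=\frac{2^d-c}{d}\,n$, and hence $m(2^{d-1}-c)=\frac{2^d-c}{d}$.
   Context: For non-negative integers $n,m,a,b$ write $(n,m)\to(a,b)$ if for every $n$-element set $V$ and every family $\mathcal{F}\subseteq 2^{V}$ with $|\mathcal{F}|\ge m$ there is an $a$-element set $T\subseteq V$ with $|\mathcal{F}_{|T}|\ge b$, where $\mathcal{F}_{|T}=\{F\cap T: F\in\mathcal{F}\}$. For non-negative integers $n,s$, $m(n,s)$ denotes the maximum integer $m$ such that $(n,m)\to(n-1,m-s)$. For fixed $s$, $m(s)=\lim_{n\to\infty} m(n,s)/n$ (this limit exists). *)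

(* Defs.v *)
From mathcomp Require Import all_boot all_order all_algebra.
Set Implicit Arguments. Unset Strict Implicit. Unset Printing Implicit Defensive.
Import Order.TTheory GRing.Theory Num.Theory.

Definition trace (n : nat) (FF : {set {set 'I_n}}) (T : {set 'I_n}) :
  {set {set 'I_n}} := [set F :&: T | F in FF].

Definition arrow (n m a b : nat) : bool :=
  [forall FF : {set {set 'I_n}},
     (m <= #|FF|) ==>
     [exists T : {set 'I_n}, (#|T| == a) && (b <= #|trace FF T|)]].

(* m(n,s): the maximum m (among m <= 2^n, i.e. among sizes of actual
   families; beyond 2^n the arrow holds vacuously) with
   (n,m) -> (n-1, m-s). *)
Definition mns (n s : nat) : nat :=
  \max_(m < (2 ^ n).+1 | arrow n m n.-1 (m - s)) m.

Local Open Scope ring_scope.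

Definition converges_to (u : nat -> rat) (L : rat) : Prop :=
  forall eps : rat, 0 < eps ->
    exists N : nat, forall n : nat, (N <= n)%N -> `|u n - L| < eps.

Definition ms_eq (s : nat) (L : rat) : Prop :=
  converges_to (fun n => (mns n s)%:R / n%:R) L.

(* Main.v *)
Require Import Defs.
From mathcomp Require Import all_boot all_order all_algebra.
From mathcomp Require Import zify ring lra.
Set Implicit Arguments. Unset Strict Implicit. Unset Printing Implicit Defensive.
Import Order.TTheory GRing.Theory Num.Theory.
Local Open Scope ring_scope.

(** Down-compression reduces the problem to hereditary families, where deleting
a vertex [v] loses exactly [deg v] sets.  With [r = c - 1], one must bound
[|F| - 1] from below when all degrees are at least [2^(d-1) - r].

Give [v] the weight [W v], the sum of [1/|A|] over the members [A] through [v],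
so that the weights add up to [|F| - 1].  By Katona's theorem applied to links,
[W v >= (2^d - 1 - r)/d] as soon as [v] has at least [d] neighbours, and at most
[1/6] is lost otherwise.  A vertex with only [d - 1] neighbours determines a
block, its closed neighbourhood, of size [d].  Inside a block [B], consider the
complements of the subsets of [B] missing from [F]: they form a hereditary
family, and counting its members against the sets of [F] that leave [B] shows
that the average weight over [B] is as large as claimed, the only loss (of [1/2])
occurring for [c = d].  Blocks that share no vertex with another block are thus
settled; a vertex in several blocks has a huge degree, and its excess weight
pays for all of them.

The extremal families are disjoint copies of a cube [2^[d]] from which [c - 1]
large sets are removed; for [c = d] two copies missing [d] sets each are joined
by an edge. *)

(** * Binary weights *)

(** The argument [k] is fuel for a structural recursion; any [k >= n] yields the number of binary
    ones of [n]. *)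
Fixpoint popcount_rec (k n : nat) : nat :=
  if k is k'.+1 then (odd n + popcount_rec k' n./2)%N else 0%N.

Definition popcount (n : nat) : nat := popcount_rec n n.

Lemma popcount_rec_stable k n : (n <= k)%N -> popcount_rec k n = popcount n.
Proof.
rewrite /popcount; elim: k {-2}k (leqnn k) n => [|K IH] k.
  by rewrite leqn0 => /eqP -> n; rewrite leqn0 => /eqP ->.
move=> kK n nk; case: k kK nk => [|k] kK nk; first by move: nk; rewrite leqn0 => /eqP ->.
case: n nk => [|n] nk.
  by rewrite /= (IH k _ 0%N).
rewrite /= uphalfE; congr (_ + _)%N; rewrite IH; [|lia|lia].
by rewrite (IH n); lia.
Qed.

Lemma popcountE n : popcount n = (odd n + popcount n./2)%N.
Proof. by case: n => // n; rewrite {1}/popcount [LHS]/= popcount_rec_stable //; lia. Qed.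

Lemma popcount_double i : popcount i.*2 = popcount i.
Proof. by rewrite popcountE odd_double doubleK. Qed.

Lemma popcount_doubleS i : popcount i.*2.+1 = (popcount i).+1.
Proof. by rewrite popcountE /= odd_double uphalf_double. Qed.

(** Reading [i] as the set of positions of its binary ones, this is the total weight of the first
    [m] finite sets in binary order. *)
Definition wt (phi : nat -> rat) (m : nat) : rat := \sum_(i < m) phi (popcount i).

Definition shift (phi : nat -> rat) (k : nat) : rat := phi k.+1.

Definition antitone (phi : nat -> rat) := forall k, phi k.+1 <= phi k.

Lemma wtS phi m : wt phi m.+1 = wt phi m + phi (popcount m).
Proof. by rewrite /wt big_ord_recr. Qed.

Lemma wt0 phi : wt phi 0 = 0.
Proof. by rewrite /wt big_ord0. Qed.

Lemma wt_double phi m : wt phi m.*2 = wt phi m + wt (shift phi) m.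
Proof.
elim: m => [|m IH]; first by rewrite !wt0 addr0.
rewrite doubleS !wtS IH popcount_double popcount_doubleS /shift; ring.
Qed.

Lemma wt_doubleS phi m : wt phi m.*2.+1 = wt phi m.+1 + wt (shift phi) m.
Proof. rewrite !wtS wt_double popcount_double; ring. Qed.

(** Numerical core of Katona's theorem: [a] counts the sets avoiding a vertex and [b] those through
    it, shifted because the vertex adds one to the size. Halving [a] and [b] splits off the last
    binary digit, and induction applies to both halves. *)
Lemma wt_add_le phi a b : antitone phi -> (b <= a)%N ->
  wt phi (a + b) <= wt phi a + wt (shift phi) b.
Proof.
elim: (a + b)%N {-2}a {-2}b phi (leqnn (a + b)%N) => {a b} [|n IH] a b phi.
  rewrite leqn0 addn_eq0 => /andP[/eqP -> /eqP ->] _ _.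
  by rewrite !wt0 addr0.
move=> abn dphi ba.
have sdphi : antitone (shift phi) by move=> k; apply: dphi.
have [->|b_gt0] := posnP b; first by rewrite addn0 wt0 addr0.
have := odd_double_half a; have := odd_double_half b.
move: a./2 b./2 => p q; case: (odd b) (odd a) => [] [] /= eb ea; subst a b.
- have -> : (1 + p.*2 + (1 + q.*2) = (p + q).+1.*2)%N by lia.
  rewrite !add1n wt_double !wt_doubleS.
  have h1 : wt phi (p + q).+1 <= wt phi p.+1 + wt (shift phi) q.
    by rewrite -addSn; apply: IH => //; lia.
  (* For [q < p] the extra unit goes to [q], and antitonicity absorbs the difference. For [p = q]
     this would break [b <= a], so it goes to [p]. *)
  have [qp|pq] : (q < p)%N \/ p = q by lia.
    have h2 : wt (shift phi) (p + q).+1 <= wt (shift phi) p + wt (shift (shift phi)) q.+1.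
      by rewrite -addnS; apply: IH => //; lia.
    move: h2; rewrite !(wtS _ q).
    have := sdphi (popcount q); rewrite -/(shift _ _).
    rewrite /shift; lra.
  subst q.
  have h2 : wt (shift phi) (p + p).+1 <= wt (shift phi) p.+1 + wt (shift (shift phi)) p.
    by rewrite -addSn; apply: IH => //; lia.
  lra.
- have -> : (p.*2 + (1 + q.*2) = (p + q).*2.+1)%N by lia.
  rewrite !add1n wt_double !wt_doubleS.
  have h1 : wt phi (p + q).+1 <= wt phi p + wt (shift phi) q.+1.
    by rewrite -addnS; apply: IH => //; lia.
  have h2 : wt (shift phi) (p + q) <= wt (shift phi) p + wt (shift (shift phi)) q.
    by apply: IH => //; lia.
  lra.
- have -> : (1 + p.*2 + q.*2 = (p + q).*2.+1)%N by lia.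
  rewrite !add1n wt_double !wt_doubleS.
  have h1 : wt phi (p + q).+1 <= wt phi p.+1 + wt (shift phi) q.
    by rewrite -addSn; apply: IH => //; lia.
  have h2 : wt (shift phi) (p + q) <= wt (shift phi) p + wt (shift (shift phi)) q.
    by apply: IH => //; lia.
  lra.
- have -> : (p.*2 + q.*2 = (p + q).*2)%N by lia.
  rewrite !add0n !wt_double.
  have h1 : wt phi (p + q) <= wt phi p + wt (shift phi) q.
    by apply: IH => //; lia.
  have h2 : wt (shift phi) (p + q) <= wt (shift phi) p + wt (shift (shift phi)) q.
    by apply: IH => //; lia.
  lra.
Qed.

Lemma wt_mono phi a b : (forall k, 0 <= phi k) -> (a <= b)%N -> wt phi a <= wt phi b.
Proof.
move=> phi0 /subnK <-; elim: (b - a)%N => [|k IH] //.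
rewrite addSn wtS; have := phi0 (popcount (k + a)); lra.
Qed.

(** Below [2 ^ k] there are ['C(k, j)] numbers with [j] ones; the induction is Pascal's rule. *)
Lemma wt_pow2 phi k : wt phi (2 ^ k) = \sum_(j < k.+1) 'C(k, j)%:R * phi j.
Proof.
elim: k phi => [|k IH] phi.
  by rewrite /wt !big_ord_recl !big_ord0 mul1r.
rewrite expnS mul2n wt_double !IH [in RHS]big_ord_recl bin0 mul1r.
rewrite [X in X + _]big_ord_recl bin0 mul1r -addrA; congr (_ + _).
rewrite [X in X + _](_ : _ = \sum_(i < k.+1) 'C(k, i.+1)%:R * shift phi i); last first.
  by rewrite [RHS]big_ord_recr /= bin_small // mul0r addr0.
rewrite -big_split /=; apply: eq_bigr => i _.
by rewrite /bump /= add1n binS natrD mulrDl.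
Qed.

(** The weight [1/#|A|] of a member [A] through [v], as a function of the size of [A :\ v] in the
    link. *)
Definition inv1 (k : nat) : rat := k.+1%:R^-1.

Lemma inv1_ge0 k : 0 <= inv1 k.
Proof. by rewrite invr_ge0 ler0n. Qed.

Lemma inv1_antitone : antitone inv1.
Proof. by move=> k; rewrite /inv1 lef_pV2 ?posrE ?ltr0n // ler_nat. Qed.

(** Termwise ['C(k, i) / (i + 1) = 'C(k + 1, i + 1) / (k + 1)]. The value is the weight of a vertex
    in a full cube on [k + 1] points. *)
Lemma wt_inv1_pow2 k : wt inv1 (2 ^ k) = (2 ^+ k.+1 - 1) / k.+1%:R.
Proof.
have k0 : k.+1%:R != 0 :> rat by rewrite pnatr_eq0.
rewrite wt_pow2; apply: (mulIf k0); rewrite divfK // mulr_suml.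
have e : forall i : 'I_k.+1, true -> 'C(k, i)%:R * inv1 i * k.+1%:R = ('C(k.+1, i.+1))%:R :> rat.
  move=> i _; have i0 : i.+1%:R != 0 :> rat by rewrite pnatr_eq0.
  have mb : k.+1%:R * 'C(k, i)%:R = i.+1%:R * 'C(k.+1, i.+1)%:R :> rat.
    by rewrite -!natrM mul_bin_diag.
  by rewrite mulrC mulrA mb mulrAC mulfV // mul1r.
rewrite (eq_bigr _ e) -natr_sum.
have -> : (\sum_(i < k.+1) 'C(k.+1, i.+1) = 2 ^ k.+1 - 1)%N.
  have := expnDn 1 1 k.+1; rewrite big_ord_recl /= => ->.
  rewrite bin0 !exp1n !muln1 addKn; apply: eq_bigr => i _.
  by rewrite !exp1n !muln1.
by rewrite natrB ?expn_gt0 // natrX.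
Qed.

(** The number [2 ^ k - 1 - i] has [k - popcount i] ones, so it is at least
    [2 ^ (k - popcount i) - 1]. Thus an index just below [2 ^ k] has few zero digits. *)
Lemma popcount_near_pow2 k i : (i < 2 ^ k)%N -> (2 ^ (k - popcount i) <= 2 ^ k - i)%N.
Proof.
elim: k i => [|k IH] i; first by rewrite expn0 ltnS leqn0 => /eqP ->.
have := odd_double_half i; move: i./2 => p; case: (odd i) => /= <-; rewrite expnS => ik.
- rewrite add1n popcount_doubleS subSS.
  have := IH p ltac:(lia).
  have : (0 < 2 ^ (k - popcount p))%N by rewrite expn_gt0.
  lia.
- rewrite add0n popcount_double.
  have := IH p ltac:(lia).
  have : (2 ^ (k.+1 - popcount p) <= 2 * 2 ^ (k - popcount p))%N.
    by rewrite -expnS leq_exp2l //; lia.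
  lia.
Qed.

(** * Hereditary families *)

Definition hereditary (T : finType) (F : {set {set T}}) :=
  forall A B : {set T}, A \in F -> B \subset A -> B \in F.

Definition deg (T : finType) (F : {set {set T}}) (v : T) := #|[set A in F | v \in A]|.

Definition link (T : finType) (F : {set {set T}}) (v : T) : {set {set T}} :=
  [set A : {set T} | (v \notin A) && (v |: A \in F)].

Lemma link_hereditary (T : finType) (F : {set {set T}}) v :
  hereditary F -> hereditary (link F v).
Proof.
move=> hF A B; rewrite !inE => /andP[vA AF] BA; apply/andP; split.
  by apply: contra vA; apply: (subsetP BA).
by apply: hF AF _; apply: setUS.
Qed.

Lemma link_sub (T : finType) (F : {set {set T}}) v :
  hereditary F -> link F v \subset [set A in F | v \notin A].
Proof.
move=> hF; apply/subsetP => A; rewrite !inE => /andP[-> AF]; rewrite andbT.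
by apply: hF AF _; apply: subsetUr.
Qed.

Lemma big_link (R : Type) (idx : R) (op : Monoid.com_law idx) (T : finType)
    (F : {set {set T}}) v (f : {set T} -> R) :
  \big[op/idx]_(A in F | v \in A) f A = \big[op/idx]_(A in link F v) f (v |: A).
Proof.
rewrite (reindex_onto (fun A => v |: A) (fun A => A :\ v)) /=; last first.
  by move=> A /andP[_ vA]; rewrite setD1K.
apply: eq_bigl => A; rewrite !inE eqxx /= andbT andbC; congr (_ && _).
apply/eqP/idP => [<-|vA]; first by rewrite !inE eqxx.
by rewrite setU1K.
Qed.

Lemma card_link (T : finType) (F : {set {set T}}) v : #|link F v| = deg F v.
Proof.
rewrite /deg -!sum1_card [RHS](eq_bigl (fun A => (A \in F) && (v \in A))).
  by rewrite (big_link _ F v (fun=> 1%N)).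
by move=> A; rewrite inE.
Qed.

Lemma sum_link (T : finType) (F : {set {set T}}) v (phi : nat -> rat) :
  \sum_(A in F | v \in A) phi #|A| = \sum_(A in link F v) shift phi #|A|.
Proof.
rewrite big_link; apply: eq_bigr => A; rewrite inE => /andP[vA _].
by rewrite cardsU1 vA.
Qed.

Lemma card_deg_split (T : finType) (F : {set {set T}}) v :
  #|F| = (#|[set A in F | v \notin A]| + deg F v)%N.
Proof.
rewrite /deg -(cardsID [set A : {set T} | v \in A] F) addnC; congr (_ + _)%N; apply: eq_card => A;
  by rewrite !inE // andbC.
Qed.

(* Katona's theorem on order ideals: among hereditary families of given size,
   an initial segment of the binary order minimises a decreasing weight. *)
Lemma katona (T : finType) (F : {set {set T}}) (phi : nat -> rat) :
  hereditary F -> antitone phi -> wt phi #|F| <= \sum_(A in F) phi #|A|.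
Proof.
elim: #|F| {-2}F (leqnn #|F|) phi => {F} [|n IH] F cF phi hF dphi.
  by move: cF; rewrite leqn0 cards_eq0 => /eqP ->; rewrite cards0 wt0 big_set0.
have [/existsP[v v0]|] := boolP [exists v, 0 < deg F v]%N; last first.
  rewrite negb_exists => /forallP noV.
  have F1 : F \subset [set set0].
    apply/subsetP => A AF; rewrite inE; apply/eqP/setP => v; rewrite inE.
    apply/negP => vA; have /negP := noV v; apply; apply/card_gt0P.
    by exists A; rewrite inE AF.
  move: F1; rewrite subset1 => /orP[] /eqP ->.
    by rewrite cards1 big_set1 cards0 wtS wt0 add0r.
  by rewrite cards0 wt0 big_set0.
(* Split at [v]: heredity puts the link inside [F0], which is the inequality [b <= a] that
   [wt_add_le] requires. *)
set F0 := [set A in F | v \notin A].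
have lF0 : link F v \subset F0 by apply: link_sub.
have l0 : (deg F v <= #|F0|)%N by rewrite -card_link subset_leq_card.
have cs := card_deg_split F v; rewrite -/F0 in cs.
rewrite cs [X in _ <= X](bigID (fun A : {set T} => v \in A)) /= sum_link.
have h1 : wt phi #|F0| <= \sum_(A in F0) phi #|A|.
  apply: IH => //; first by lia.
  move=> A B; rewrite !inE => /andP[AF vA] BA; apply/andP; split; first exact: hF AF BA.
  by apply: contra vA; apply: (subsetP BA).
have h2 : wt (shift phi) #|link F v| <= \sum_(A in link F v) shift phi #|A|.
  apply: IH; [by rewrite card_link; lia | exact: link_hereditary |].
  by move=> k; apply: dphi.
have -> : \sum_(i in F | v \notin i) phi #|i| = \sum_(A in F0) phi #|A|.
  by apply: eq_bigl => A; rewrite !inE.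
have := wt_add_le dphi l0; rewrite card_link in h2; lra.
Qed.

(** * Compression *)

Definition restr (T : finType) (F : {set {set T}}) (S : {set T}) : {set {set T}} :=
  [set A :&: S | A in F].

(** The down-shift at [v]: each pair [A], [v |: A] keeps its number of members, the lower set being
    filled first. *)
Definition compress (T : finType) (v : T) (F : {set {set T}}) : {set {set T}} :=
  [set A : {set T} | if v \in A then (A \in F) && (A :\ v \in F) else (A \in F) || (v |: A \in F)].

Definition closed_at (T : finType) (v : T) (F : {set {set T}}) :=
  forall A : {set T}, A \in F -> A :\ v \in F.

Lemma card_compress (T : finType) (v : T) (F : {set {set T}}) : #|compress v F| = #|F|.
Proof.
rewrite (card_deg_split _ v) [RHS](card_deg_split _ v) -!card_link.
set X := [set A in F | v \notin A]; set Y := link F v.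
have -> : [set A in compress v F | v \notin A] = X :|: Y.
  by apply/setP => A; rewrite !inE; case: (v \in A) => /=; rewrite ?andbF ?andbT.
have -> : link (compress v F) v = X :&: Y.
  apply/setP => A; rewrite !inE eqxx /= andbC.
  have [vA|vA] := boolP (v \in A); rewrite /= ?andbF ?andbT //.
  by rewrite setU1K // andbC.
by rewrite cardsUI.
Qed.

(** If [v] is outside [S], then [A] and [v |: A] have the same trace and no new trace arises. If [v]
    is in [S], the traces of the compression lie in the compression of the traces. *)
Lemma restr_compress (T : finType) (v : T) (F : {set {set T}}) (S : {set T}) :
  (#|restr (compress v F) S| <= #|restr F S|)%N.
Proof.
have [vS|vS] := boolP (v \in S); last first.
  apply: subset_leq_card; apply/subsetP => _ /imsetP[A AF ->].
  move: AF; rewrite inE; case: ifP => [vA /andP[AF _]|vA /orP[AF|AF]]; try exact: imset_f.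
  apply/imsetP; exists (v |: A) => //; apply/setP => x; rewrite !inE.
  by case: eqP => [->|//]; rewrite (negbTE vS) !andbF.
rewrite -(card_compress v (restr F S)); apply: subset_leq_card.
apply/subsetP => _ /imsetP[A AF ->]; move: AF; rewrite !inE vS andbT.
case: ifP => vA.
  case/andP => AF AvF; apply/andP; split; first exact: imset_f.
  by apply/imsetP; exists (A :\ v) => //; rewrite setIDAC.
case/orP => AF; apply/orP; [left; exact: imset_f | right].
apply/imsetP; exists (v |: A) => //; rewrite setIUl; congr (_ :|: _).
by apply/eqP; rewrite eq_sym; apply/eqP/setIidPl; rewrite sub1set.
Qed.

Lemma compress_closed (T : finType) (v : T) (F : {set {set T}}) : closed_at v (compress v F).
Proof.
move=> A; rewrite !inE eqxx /=; case: ifP => vA; first by case/andP => _ ->.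
have -> : A :\ v = A by apply/setDidPl; rewrite disjoint_sym disjoints1 vA.
by [].
Qed.

(** Compressing at one vertex does not undo earlier compressions, so a single pass over all vertices
    yields a hereditary family. *)
Lemma closed_compress (T : finType) (v w : T) (F : {set {set T}}) :
  closed_at w F -> closed_at w (compress v F).
Proof.
have [->|vw] := eqVneq w v; first by move=> _; apply: compress_closed.
move=> cF A; rewrite !inE eq_sym vw /=; case: ifP => vA.
  by case/andP => /cF -> /cF; rewrite !setDDl setUC => ->.
case/orP => /cF; first by move=> ->.
rewrite setDUl (setDidPl _) ?disjoints1 ?inE 1?eq_sym // => ->; exact: orbT.
Qed.

Lemma closed_hereditary (T : finType) (F : {set {set T}}) :
  (forall v, closed_at v F) -> hereditary F.
Proof.
move=> cF A B; elim: #|A :\: B| {-2}A (leqnn #|A :\: B|) => {A} [|n IH] A.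
  rewrite leqn0 cards_eq0 setD_eq0 => AB AF BA.
  by have -> : B = A by apply/eqP; rewrite eqEsubset BA.
move=> cA AF BA; have [AB|] := boolP (A \subset B).
  by have -> : B = A by apply/eqP; rewrite eqEsubset BA.
case/subsetPn => v vA vB; apply: (IH (A :\ v)); last 2 first.
- exact: cF.
- by rewrite subsetD1 BA vB.
move: cA; rewrite (cardsD1 v) !inE vA vB /= add1n ltnS; congr (_ <= _)%N.
by apply: eq_card => x; rewrite !inE andbCA.
Qed.

Lemma exists_compression (T : finType) (F : {set {set T}}) :
  exists G : {set {set T}}, [/\ hereditary G, #|G| = #|F|
    & forall S, (#|restr G S| <= #|restr F S|)%N].
Proof.
have [G [cG sG rG]] : exists G : {set {set T}},
    [/\ forall v, v \in enum T -> closed_at v G, #|G| = #|F|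
      & forall S, (#|restr G S| <= #|restr F S|)%N].
  elim: (enum T) => [|v s [G [cG sG rG]]]; first by exists F.
  exists (compress v G); split; last 2 first.
  - by rewrite card_compress.
  - by move=> S; apply: leq_trans (restr_compress _ _ _) (rG S).
  move=> w; rewrite inE => /predU1P[->|/cG]; first exact: compress_closed.
  exact: closed_compress.
exists G; split => //; apply: closed_hereditary => v.
by apply: cG; rewrite mem_enum.
Qed.

(** By heredity the traces on the complement of [x] are exactly the members avoiding [x]. *)
Lemma card_restr_hereditary (T : finType) (F : {set {set T}}) x :
  hereditary F -> (#|restr F (~: [set x])| + deg F x)%N = #|F|.
Proof.
move=> hF; rewrite (card_deg_split F x); congr (#|pred_of_set _| + _)%N.
apply/setP => A; rewrite inE; apply/imsetP/andP => [[B BF ->]|[AF xA]].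
  by rewrite !inE eqxx andbF; split => //; apply: hF BF _; apply: subsetIl.
by exists A => //; apply/esym/setIidPl; rewrite subsetC sub1set inE.
Qed.

(** * Vertex weights *)

Definition weight (T : finType) (F : {set {set T}}) (v : T) : rat :=
  \sum_(A in F | v \in A) #|A|%:R^-1.

Lemma weight_ge0 (T : finType) (F : {set {set T}}) v : 0 <= weight F v.
Proof. by apply: sumr_ge0 => A _; rewrite invr_ge0 ler0n. Qed.

Lemma sum_weight (T : finType) (F : {set {set T}}) :
  set0 \in F -> \sum_v weight F v = #|F|%:R - 1.
Proof.
move=> F0; rewrite /weight (exchange_big_dep (fun A => A \in F)) /=; last by move=> v A _ /andP[].
have -> : #|F|%:R - 1 = \sum_(A in F | A != set0) 1 :> rat.
  rewrite (cardsD1 set0) F0 natrD addrAC subrr add0r -sum1_card natr_sum.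
  by apply: eq_bigl => A; rewrite !inE andbC.
rewrite [LHS](bigID (fun A => A == set0)) /= [X in X + _]big1 ?add0r => [|A].
  apply: eq_bigr => A /andP[AF A0].
  rewrite (eq_bigl (fun v => v \in A)); last by move=> v; rewrite AF.
  by rewrite sumr_const -[_ *+ _]mulr_natl mulfV // pnatr_eq0 cards_eq0.
case/andP => _ /eqP ->; rewrite big1 // => v /andP[_]; by rewrite inE.
Qed.

Lemma weight_ge (T : finType) (F : {set {set T}}) v :
  hereditary F -> wt inv1 (deg F v) <= weight F v.
Proof.
move=> hF; rewrite /weight (sum_link _ _ (fun k => k%:R^-1)) -card_link.
by apply: katona inv1_antitone; apply: link_hereditary.
Qed.

(** Katona's bound is used at the vertices of [H] and nonnegativity elsewhere. Applied to the
    missing sets of a block, it limits how many vertices can have large degree there. *)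
Lemma card_ge_wt (T : finType) (F : {set {set T}}) (H : {set T}) e :
  hereditary F -> set0 \in F -> (forall v, v \in H -> (e <= deg F v)%N) ->
  #|H|%:R * wt inv1 e + 1 <= #|F|%:R.
Proof.
move=> hF F0 He; rewrite -lerBrDr -sum_weight // mulr_natl -sumr_const.
rewrite [X in _ <= X](bigID (fun v => v \in H)) /=.
apply: (@le_trans _ _ (\sum_(v in H) weight F v)).
  apply: ler_sum => v vH; apply: le_trans (weight_ge _ hF).
  exact: wt_mono inv1_ge0 (He _ vH).
by rewrite lerDl; apply: sumr_ge0 => v _; apply: weight_ge0.
Qed.

(** A closed neighbourhood: [[set v; v]] is [[set v]], so [v] itself is counted as soon as its
    singleton is a member. *)
Definition nbhd (T : finType) (F : {set {set T}}) (v : T) := [set z | [set v; z] \in F].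

Lemma sub_nbhd (T : finType) (F : {set {set T}}) v A :
  hereditary F -> A \in F -> v \in A -> A \subset nbhd F v.
Proof.
move=> hF AF vA; apply/subsetP => z zA; rewrite inE; apply: hF AF _.
by rewrite subUset !sub1set vA.
Qed.

Lemma deg_le_nbhd (T : finType) (F : {set {set T}}) v :
  hereditary F -> (deg F v <= 2 ^ (#|nbhd F v|.-1))%N.
Proof.
move=> hF; have [->//|] := posnP (deg F v); rewrite -card_link.
case/card_gt0P => A0; rewrite inE => /andP[vA0 A0F].
have vN : v \in nbhd F v.
  by apply: (subsetP (sub_nbhd hF A0F _)); rewrite !inE eqxx.
have -> : #|nbhd F v|.-1 = #|nbhd F v :\ v| by rewrite [in LHS](cardsD1 v) vN.
rewrite -card_powerset; apply: subset_leq_card; apply/subsetP => A.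
rewrite !inE => /andP[vA AF]; rewrite subsetD1 vA andbT.
apply: subset_trans (sub_nbhd hF AF _); first exact: subsetUr.
by rewrite !inE eqxx.
Qed.

(** For [k <= 7] the bound 50 on [m] suffices; beyond, [7 * k <= 2 ^ k]. *)
Lemma mul7_le_of_exp2 k m : (50 <= m)%N -> (2 ^ k < m)%N -> (7 * k <= m)%N.
Proof.
move=> m50 km; have [k7|k7] := leqP k 7; first by lia.
suff : (7 * k <= 2 ^ k)%N by lia.
rewrite -(subnKC k7); elim: (k - 8)%N => [|j IH]; first by [].
by rewrite addnS expnS; lia.
Qed.

Lemma wt_tail phi m k delta :
  (forall i, (m <= i < m + k)%N -> phi (popcount i) <= delta) ->
  wt phi (m + k) <= wt phi m + k%:R * delta.
Proof.
elim: k => [|k IH] H; first by rewrite addn0 mul0r addr0.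
rewrite addnS wtS -[in X in _ <= X]natr1 mulrDl mul1r addrA.
by apply: lerD; [apply: IH => i ?; apply: H | apply: H]; lia.
Qed.

Lemma wt_small_pow2 k : (0 < k)%N -> wt (fun j => (j <= 1)%:R) (2 ^ k) = k.+1%:R.
Proof.
case: k => // k _; rewrite wt_pow2 !big_ord_recl big1 => [|i _]; last by rewrite /= mulr0.
by rewrite /bump /= bin0 bin1 !mulr1 addr0 [RHS]mulrS.
Qed.

(** The link is compared with a full cube on [d - 1] points. Each of the last [r] indices before
    [2 ^ d.-1] costs at most [7/(6d)], in total at most [r/d + 1/6]. *)
Lemma weight_nbhd (T : finType) (F : {set {set T}}) v d r :
  (50 <= d)%N -> (r < d)%N -> hereditary F -> (2 ^ d.-1 <= deg F v + r)%N ->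
  (2 ^+ d - 1 - r%:R) / d%:R + (#|nbhd F v|%:R - d%:R - 1) / 6%:R <= weight F v.
Proof.
move=> d50 rd hF dv.
pose psi : nat -> rat := fun j => (j <= 1)%:R.
(* Subtracting [1/6] on sets of size at most one keeps the weight decreasing, and
   recovers [1/6] from every neighbour of [v]. *)
pose phi j := inv1 j - psi j / 6%:R.
have dphi : antitone phi.
  case=> [|[|k]]; rewrite /phi /psi /=; [by rewrite /inv1; lra | by rewrite /inv1; lra |].
  by rewrite !mul0r !subr0; apply: inv1_antitone.
have phi0 k : 0 <= phi k.
  case: k => [|[|k]]; rewrite /phi /psi /=; [by rewrite /inv1; lra | by rewrite /inv1; lra |].
  by rewrite !mul0r !subr0; apply: inv1_ge0.
have wtphi m : wt phi m = wt inv1 m - wt psi m / 6%:R.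
  by rewrite /wt mulr_suml -sumrB.
have dp : (2 ^ d.-1 - r + r = 2 ^ d.-1)%N.
  by rewrite subnK // (leq_trans _ (ltnW (ltn_expl d.-1 (ltnSn 1)))) //; lia.
have d0 : 0 < d%:R :> rat by rewrite ltr0n; lia.
have h1 : wt phi (2 ^ d.-1) <= wt phi (2 ^ d.-1 - r) + r%:R * (7%:R / 6%:R / d%:R).
  rewrite -{1}dp; apply: wt_tail => i; rewrite dp => /andP[ri i2].
  apply: (@le_trans _ _ (inv1 (popcount i))).
    by rewrite /phi /psi lerBlDr lerDl divr_ge0 ?ler0n.
  (* Being within [r < d] of [2 ^ d.-1], the index [i] has at most [d/7] zero digits, hence
     [popcount i + 1] is at least [6d/7]. *)
  have := popcount_near_pow2 i2 => hp.
  have h7 : (6 * d <= 7 * (popcount i).+1)%N.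
    have := @mul7_le_of_exp2 (d.-1 - popcount i) d d50 ltac:(lia); lia.
  rewrite /inv1 -(ler_pM2r d0) divfK ?gt_eqF // mulrC ler_pdivrMr ?ltr0n //.
  by move: h7; rewrite -(ler_nat rat) !natrM; lra.
have h2 : wt phi (2 ^ d.-1 - r) <= wt phi (deg F v) by apply: wt_mono phi0 _; lia.
have h3 : wt phi (deg F v) <= \sum_(A in link F v) phi #|A|.
  by rewrite -card_link; apply: katona (link_hereditary hF) dphi.
have h4 : \sum_(A in link F v) phi #|A| = weight F v - (\sum_(A in link F v) psi #|A|) / 6%:R.
  rewrite /weight (sum_link _ _ (fun k => k%:R^-1)) /phi mulr_suml -sumrB.
  by apply: eq_bigr.
have h5 : #|nbhd F v|%:R <= \sum_(A in link F v) psi #|A|.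
  (* The vertex [v] goes to the empty set and every other neighbour to its singleton, all members of
     the link of size at most one. *)
  pose f (z : T) : {set T} := [set z] :\ v.
  have fi : injective f.
    move=> x y /setP xy; have := xy x; have := xy y; rewrite !inE !eqxx !andbT.
    case: (eqVneq x v) => [->|xv]; case: (eqVneq y v) => [->|yv] //=.
      by rewrite (negbTE xv).
    by move/eqP.
  rewrite -(card_imset _ fi) -sum1_card natr_sum.
  apply: (@le_trans _ _ (\sum_(A in f @: nbhd F v) psi #|A|)).
    apply: ler_sum => _ /imsetP[z _ ->]; rewrite /psi /f.
    by rewrite (leq_trans (subset_leq_card (subsetDl _ _))) ?cards1.
  rewrite [X in _ <= X](bigID (fun A => A \in f @: nbhd F v)) /=.
  rewrite (eq_bigl (fun A => (A \in link F v) && (A \in f @: nbhd F v))).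
    by rewrite lerDl; apply: sumr_ge0 => A _; rewrite ler0n.
  move=> A; rewrite andb_idl // => /imsetP[z]; rewrite inE => zN ->.
  rewrite !inE eqxx /=; apply: hF zN _; apply/subsetP => x; rewrite !inE.
  by case: (x == v).
have e2 : d.-1.+1 = d by lia.
move: h1; rewrite wtphi wt_inv1_pow2 wt_small_pow2 ?e2; last by lia.
have h6 : r%:R * (7%:R / 6%:R / d%:R) <= r%:R / d%:R + 6%:R^-1 :> rat.
  have : r%:R / d%:R <= 1 :> rat by rewrite ler_pdivrMr // mul1r ler_nat ltnW.
  by move: (d%:R^-1) => x; lra.
rewrite !mulrBl; move: (d%:R^-1) (2 ^+ d) h6 => x y; lra.
Qed.

(** * Blocks *)

(* Members are the complements in [B] of the missing sets, so that [missing F B]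
   is hereditary when [F] is. *)
Definition missing (T : finType) (F : {set {set T}}) (B : {set T}) : {set {set T}} :=
  [set S in powerset B | B :\: S \notin F].

Definition outdeg (T : finType) (F : {set {set T}}) (B : {set T}) (y : T) :=
  #|[set A in F | (y \in A) && ~~ (A \subset B)]|.

Definition outweight (T : finType) (F : {set {set T}}) (B : {set T}) (y : T) : rat :=
  \sum_(A in F | (y \in A) && ~~ (A \subset B)) #|A|%:R^-1.

Lemma missing_hereditary (T : finType) (F : {set {set T}}) B :
  hereditary F -> hereditary (missing F B).
Proof.
move=> hF S S'; rewrite !inE => /andP[SB SF] S'S; rewrite (subset_trans S'S SB) /=.
by apply: contra SF => SF; apply: hF SF _; apply: setDS.
Qed.

Lemma card_missing_compl (T : finType) (F X : {set {set T}}) (B : {set T}) :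
  X \subset powerset B ->
  #|X :\: F| = #|[set S in missing F B | B :\: S \in X]|.
Proof.
move=> XB; rewrite -[RHS](card_in_imset (f := fun S : {set T} => B :\: S)) => [|S S'].
  apply: eq_card => A; apply/idP/imsetP => [|[S]].
    rewrite inE => /andP[AF AX]; have AB : A \subset B by have := subsetP XB _ AX; rewrite inE.
    have e : B :\: (B :\: A) = A by rewrite setDDr setDv set0U; apply/setIidPr.
    by exists (B :\: A) => //; rewrite !inE subsetDl /= e AF.
  by rewrite !inE => /andP[/andP[_ SF] SX] ->; rewrite SF.
rewrite !inE => /andP[/andP[SB _] _] /andP[/andP[SB' _] _] e.
have := congr1 (setD B) e; rewrite !setDDr !setDv !set0U.
by rewrite (setIidPr SB) (setIidPr SB').
Qed.

Lemma card_missing (T : finType) (F : {set {set T}}) (B : {set T}) :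
  (#|[set A in F | A \subset B]| + #|missing F B| = 2 ^ #|B|)%N.
Proof.
rewrite -card_powerset -(cardsID F (powerset B)); congr (_ + _)%N.
  by apply: eq_card => A; rewrite !inE andbC.
rewrite (@card_missing_compl _ _ _ B) //; apply: eq_card => S; rewrite !inE.
by rewrite subsetDl andbT.
Qed.

Lemma card_missing_at (T : finType) (F : {set {set T}}) (B : {set T}) v : v \in B ->
  (#|[set A in F | (v \in A) && (A \subset B)]|
   + #|[set S in missing F B | v \notin S]| = 2 ^ (#|B|.-1))%N.
Proof.
move=> vB; pose X := [set A in powerset B | v \in A].
have -> : #|B|.-1 = #|B :\ v| by rewrite [in LHS](cardsD1 v) vB.
have -> : (2 ^ #|B :\ v| = #|X|)%N.
  rewrite -card_powerset -[RHS]/(deg (powerset B) v) -card_link.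
  apply: eq_card => A; rewrite !inE subUset sub1set vB /= subsetD1 andbC.
  by [].
rewrite -(cardsID F X); congr (_ + _)%N.
  by apply: eq_card => A; rewrite !inE andbC [X in X && _]andbC.
rewrite (@card_missing_compl _ _ _ B); last by apply/subsetP => A; rewrite inE => /andP[].
by apply: eq_card => S; rewrite !inE subsetDl vB andbT.
Qed.

(** Complementation in [B] exchanges containing and avoiding [y]: the absent subsets of [B] through
    [y] correspond to the members of [missing F B] that avoid [y]. *)
Lemma deg_block (T : finType) (F : {set {set T}}) (B : {set T}) y : y \in B ->
  (deg F y + #|missing F B| = 2 ^ (#|B|.-1) + outdeg F B y + deg (missing F B) y)%N.
Proof.
move=> yB; rewrite (card_deg_split (missing F B) y) -(card_missing_at F yB).
have -> : (deg F y = #|[set A in F | (y \in A) && (A \subset B)]| + outdeg F B y)%N.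
  rewrite /deg -(cardsID (powerset B)); congr (_ + _)%N; apply: eq_card => A;
    by rewrite !inE; case: (A \in F); case: (y \in A); case: (A \subset B).
lia.
Qed.

Lemma deg_le_half (T : finType) (F : {set {set T}}) v :
  hereditary F -> (2 * deg F v <= #|F|)%N.
Proof.
move=> hF; rewrite [X in (_ <= X)%N](card_deg_split F v).
have := subset_leq_card (link_sub v hF); rewrite card_link; lia.
Qed.

Lemma outweight_ge0 (T : finType) (F : {set {set T}}) B y : 0 <= outweight F B y.
Proof. by apply: sumr_ge0 => A _; rewrite invr_ge0 ler0n. Qed.

(** Any outer set through [y] contains an outer pair through [y], which alone has weight [1/2]. *)
Lemma outweight_ge_half (T : finType) (F : {set {set T}}) (B : {set T}) y :
  hereditary F -> y \in B -> (0 < outdeg F B y)%N -> 2%:R^-1 <= outweight F B y.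
Proof.
move=> hF yB /card_gt0P[A]; rewrite inE => /and3P[AF yA /subsetPn[z zA zB]].
have yz : y != z by apply: contra zB => /eqP <-.
rewrite /outweight (bigD1 [set y; z]) /=.
  rewrite cards2 yz lerDl; apply: sumr_ge0 => S _; by rewrite invr_ge0 ler0n.
rewrite !inE eqxx /= subUset !sub1set (negbTE zB) andbF andbT.
by apply: hF AF _; rewrite subUset !sub1set yA.
Qed.

(* Either every outer set has at most five elements, or an outer set with six
   elements contains sixteen outer sets of size at most six. *)
Lemma outweight_ge2 (T : finType) (F : {set {set T}}) (B : {set T}) y :
  hereditary F -> y \in B -> (10 <= outdeg F B y)%N -> 2%:R <= outweight F B y.
Proof.
move=> hF yB e10; pose X := [set A in F | (y \in A) && ~~ (A \subset B)].
have wX : outweight F B y = \sum_(A in X) #|A|%:R^-1.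
  by apply: eq_bigl => A; rewrite inE.
have [/existsP[A /andP[AX A6]]|] := boolP [exists A, (A \in X) && (6 <= #|A|)%N]; last first.
  rewrite negb_exists => /forallP X5; rewrite wX.
  apply: (@le_trans _ _ (\sum_(A in X) 5%:R^-1)).
    rewrite sumr_const -[_ *+ _]mulr_natl.
    have : 10%:R <= #|X|%:R :> rat by rewrite ler_nat.
    lra.
  apply: ler_sum => A AX; have := X5 A; rewrite AX /= -ltnNge ltnS => A5.
  rewrite lef_pV2 ?posrE ?ltr0n ?ler_nat //.
  by apply/card_gt0P; exists y; move: AX; rewrite inE => /and3P[].
move: AX; rewrite inE => /and3P[AF yA /subsetPn[z zA zB]].
have yz : y != z by apply: contra zB => /eqP <-.
(* The sixteen sets are [{y, z}] joined with the subsets of a four-element [R]; the point [z]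
   outside [B] makes them outer. *)
have [R] : exists R, R \in [set R : {set T} | R \subset A :\ y :\ z & #|R| == 4].
  apply/card_gt0P; rewrite cards_draws bin_gt0.
  move: A6; rewrite (cardsD1 y) yA (cardsD1 z) !inE zA eq_sym yz /=; lia.
rewrite inE => /andP[RA /eqP R4].
have yR : y \notin R by apply/negP => /(subsetP RA); rewrite !inE eqxx andbF.
have zR : z \notin R by apply/negP => /(subsetP RA); rewrite !inE eqxx.
pose f (S : {set T}) := y |: (z |: S).
have fi : {in powerset R &, injective f}.
  move=> S S'; rewrite !inE => SR SR' e.
  have fK (Q : {set T}) : Q \subset R -> f Q :\ y :\ z = Q.
    move=> QR; rewrite /f setU1K ?setU1K //; first by apply: contra zR; apply: (subsetP QR).
    rewrite !inE negb_or yz /=; by apply: contra yR; apply: (subsetP QR).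
  by rewrite -(fK S) // e fK.
have fX : f @: powerset R \subset X.
  apply/subsetP => A0 /imsetP[S]; rewrite inE => SR ->; rewrite !inE eqxx /=.
  apply/andP; split; last by apply/subsetPn; exists z; rewrite ?inE ?eqxx ?orbT.
  apply: hF AF _; rewrite !subUset !sub1set yA zA /=; apply: subset_trans SR _.
  by apply: subset_trans RA _; rewrite setDDl; apply: subsetDl.
rewrite wX (big_setID (f @: powerset R)) /= (setIidPr fX).
apply: (@le_trans _ _ (\sum_(A in f @: powerset R) 6%:R^-1)).
  rewrite sumr_const card_in_imset // card_powerset R4 -[_ *+ _]mulr_natl.
  have -> : (2 ^ 4 = 16)%N by [].
  lra.
rewrite -[X in X <= _]addr0; apply: lerD; last first.
  by apply: sumr_ge0 => S _; rewrite invr_ge0 ler0n.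
apply: ler_sum => A0 /imsetP[S]; rewrite inE => SR ->.
have S4 := subset_leq_card SR; rewrite R4 in S4.
rewrite lef_pV2 ?posrE ?ltr0n ?ler_nat //.
  by rewrite /f !cardsU1 (leq_trans (leq_add (leq_b1 _) (leq_add (leq_b1 _) S4))).
by apply/card_gt0P; exists y; rewrite !inE eqxx.
Qed.

(** Members inside [B] spend their whole unit of weight on [B], so they contribute the number of
    nonempty ones. *)
Lemma sum_weight_block (T : finType) (F : {set {set T}}) (B : {set T}) :
  set0 \in F ->
  \sum_(v in B) weight F v =
    2 ^+ #|B| - #|missing F B|%:R - 1 + \sum_(v in B) outweight F B v.
Proof.
move=> F0; pose FB := [set A in F | A \subset B].
have wE v : weight F v = weight FB v + outweight F B v.
  rewrite /weight (bigID (fun A : {set T} => A \subset B)) /=; congr (_ + _).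
    by apply: eq_bigl => A; rewrite !inE andbAC.
  by apply: eq_bigl => A; rewrite -andbA.
under eq_bigr => v _ do rewrite wE.
rewrite big_split /=; congr (_ + _).
have -> : \sum_(v in B) weight FB v = \sum_v weight FB v.
  rewrite [RHS](bigID (fun v => v \in B)) /= [X in _ = _ + X]big1 ?addr0 // => v vB.
  rewrite /weight big1 // => A /andP[]; rewrite inE => /andP[_ AB] vA.
  by rewrite (subsetP AB _ vA) in vB.
rewrite sum_weight; last by rewrite inE F0 sub0set.
have := card_missing F B; rewrite -/FB => /(congr1 (fun n => n%:R : rat)).
rewrite natrD natrX => <-; ring.
Qed.

Lemma wt_inv1_9 : 4%:R <= wt inv1 9.
Proof. rewrite /wt !big_ord_recr big_ord0 /popcount /= !(addn0, add0n, add1n) /inv1; lra. Qed.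

Lemma wt_inv1_8 : 3%:R <= wt inv1 8.
Proof. rewrite /wt !big_ord_recr big_ord0 /popcount /= !(addn0, add0n, add1n) /inv1; lra. Qed.

Lemma wt_inv1_2 : wt inv1 2 = 3%:R / 2%:R.
Proof. rewrite /wt !big_ord_recr big_ord0 /popcount /= !(addn0, add0n, add1n) /inv1; lra. Qed.

Lemma wt_inv1_1 : wt inv1 1 = 1.
Proof. rewrite /wt !big_ord_recr big_ord0 /popcount /= /inv1; lra. Qed.

(* The weight a block may lack: [1/2] in the boundary case [c = d]. *)
Definition half_if (b : bool) : rat := if b then 2%:R^-1 else 0.

Lemma half_if_ge0 b : 0 <= half_if b.
Proof. by case: b; rewrite /half_if ?invr_ge0 ?ler0n. Qed.

(** For [g] equal to 1, in 2..7, equal to 8, or in 9..17, the bounds 1, 3/2, 3 and 4 on [wt inv1 g]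
    contradict [d >= 50]. The value 18 is chosen so that [g - 9 >= 9] later. *)
Lemma needed_ge18 (d k g : nat) : (50 <= d)%N -> (0 < g)%N ->
  (d + 1 <= k + 2 * g)%N -> k%:R * wt inv1 g + 3%:R <= g%:R + d%:R ->
  (18 <= g)%N.
Proof.
move=> d50 g0 kg h; rewrite leqNgt; apply/negP => g17.
have kR : d%:R + 1 - 2%:R * g%:R <= k%:R :> rat.
  by move: kg; rewrite -(ler_nat rat) (natrD _ k) natrM natrD; lra.
have dR : 50%:R <= d%:R :> rat by rewrite ler_nat.
have gR : g%:R <= 17%:R :> rat by rewrite ler_nat.
have lb w0 m : w0 <= wt inv1 m -> 0 <= w0 -> (m <= g)%N ->
    (d%:R + 1 - 2%:R * g%:R) * w0 + 3%:R <= g%:R + d%:R.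
  move=> w0m w00 mg; apply: le_trans h; rewrite lerD2r.
  apply: (@le_trans _ _ (k%:R * w0)); first exact: ler_wpM2r.
  apply: ler_wpM2l => //; apply: le_trans w0m _; exact: wt_mono inv1_ge0 mg.
have [g9|g8] := leqP 9 g.
  by have := lb _ _ wt_inv1_9 ltac:(lra) g9; lra.
have [e8|g7] := leqP 8 g.
  have := lb _ _ wt_inv1_8 ltac:(lra) e8.
  have : g%:R <= 8%:R :> rat by rewrite ler_nat.
  lra.
have [g2|g1] := leqP 2 g.
  have := lb (3%:R / 2%:R) 2%N ltac:(rewrite wt_inv1_2; lra) ltac:(lra) g2.
  have : g%:R <= 7%:R :> rat by rewrite ler_nat.
  lra.
have := lb 1 1%N ltac:(rewrite wt_inv1_1; lra) ltac:(lra) g0.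
have -> : g = 1%N by lia.
lra.
Qed.

Lemma exp2_gt_cubic x : (15 <= x)%N -> (2 * x * x * x + x * x < 2 ^ x.-2)%N.
Proof.
move=> x15; rewrite -(subnK x15); elim: (x - 15)%N => [|j IH].
  have -> : ((0 + 15).-2 = 6 + 7)%N by [].
  have -> : (2 ^ (6 + 7) = 64 * 128)%N by rewrite expnD.
  lia.
have -> : (j.+1 + 15).-2 = (j + 15).-2.+1 by lia.
have -> : (j.+1 + 15 = (j + 15).+1)%N by lia.
rewrite expnS; move: IH; have : (15 <= j + 15)%N by lia.
move: (2 ^ (j + 15).-2)%N => e; move: (j + 15)%N => y; nia.
Qed.

(** * Hereditary families of large minimum degree *)

Section MinDegree.
Variables (T : finType) (F : {set {set T}}) (d r : nat).
Hypotheses (d50 : (50 <= d)%N) (rd : (r < d)%N) (hF : hereditary F).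
Hypothesis degF : forall v, (2 ^ d.-1 <= deg F v + r)%N.

Let rsmall : (2 * d * d * d + d * d < 2 ^ d.-2)%N.
Proof. by apply: exp2_gt_cubic; lia. Qed.

Let deg_gt0 v : (0 < deg F v)%N.
Proof.
have := degF v; have : (2 ^ d.-2 <= 2 ^ d.-1)%N by rewrite leq_exp2l //; lia.
move: rsmall; nia.
Qed.

Lemma mem_nbhd v : v \in nbhd F v.
Proof.
have /card_gt0P[A] := deg_gt0 v; rewrite inE => /andP[AF vA].
exact: (subsetP (sub_nbhd hF AF vA)).
Qed.

Lemma card_nbhd_ge v : (d <= #|nbhd F v|)%N.
Proof.
rewrite leqNgt; apply/negP => Nd.
have h1 := deg_le_nbhd v hF; have h2 := degF v.
have h3 : (2 ^ #|nbhd F v|.-1 <= 2 ^ d.-2)%N by rewrite leq_exp2l //; lia.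
have h4 : (2 ^ d.-1 = 2 * 2 ^ d.-2)%N by rewrite -expnS; congr (_ ^ _)%N; lia.
move: rsmall; nia.
Qed.

Lemma outdeg_closed v : outdeg F (nbhd F v) v = 0%N.
Proof.
apply/eqP; rewrite cards_eq0; apply/eqP/setP => A; rewrite !inE.
by apply/negP => /and3P[AF vA]; rewrite (sub_nbhd hF AF vA).
Qed.

Lemma outdeg_open (B : {set T}) y :
  #|B| = d -> y \in B -> nbhd F y != B -> (0 < outdeg F B y)%N.
Proof.
move=> cB yB NB; have : ~~ (nbhd F y \subset B).
  apply: contra NB => NB; rewrite eqEcard NB cB; exact: card_nbhd_ge.
case/subsetPn => z; rewrite inE => zF zB; apply/card_gt0P; exists [set y; z].
by rewrite !inE zF eqxx /= subUset !sub1set (negbTE zB) andbF.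
Qed.

Lemma set0_mem (v : T) : set0 \in F.
Proof.
have := mem_nbhd v; rewrite inE => vF; apply: hF vF _; exact: sub0set.
Qed.

Lemma deg_missing_closed x y : #|nbhd F x| = d -> y \in nbhd F x ->
  (#|missing F (nbhd F x)| <= r + outdeg F (nbhd F x) y + deg (missing F (nbhd F x)) y)%N.
Proof. by move=> cB yB; have := deg_block F yB; have := degF y; rewrite cB; lia. Qed.

(** The sets leaving [B] must supply the weight [#|M| - r], up to the allowed half. Vertices with
    another neighbourhood than [B] supply [1/2] each; if they are too few, Katona's bound on [M]
    forces [g >= 18], and then enough vertices supply 2 each. *)
Lemma weight_block x0 : #|nbhd F x0| = d ->
  2 ^+ d - 1 - r%:R - half_if (r.+1 == d) <= \sum_(v in nbhd F x0) weight F v.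
Proof.
move=> cB; rewrite (sum_weight_block _ (set0_mem x0)) cB.
set B := nbhd F x0 in cB *; set M := missing F B.
have x0B : x0 \in B by apply: mem_nbhd.
have hM : hereditary M by apply: missing_hereditary.
suff : #|M|%:R - r%:R - half_if (r.+1 == d) <= \sum_(v in B) outweight F B v by lra.
have sge0 : 0 <= \sum_(v in B) outweight F B v.
  by apply: sumr_ge0 => v _; apply: outweight_ge0.
have eps0 := half_if_ge0 (r.+1 == d).
have [Nr|Nr] := leqP #|M| r.
  have : #|M|%:R <= r%:R :> rat by rewrite ler_nat.
  lra.
(* [g] is the weight still needed from the sets leaving [B]. Every vertex of [C] lies
   in at least [g] members of [M]; any other vertex [y] of [B] has at least
   [g - deg M y] outer sets. *)
pose g := (#|M| - r)%N; have Ng : #|M| = (g + r)%N by rewrite /g; lia.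
have g0 : (0 < g)%N by rewrite /g; lia.
rewrite Ng natrD addrK.
have M0 : set0 \in M.
  have /card_gt0P[S SM] : (0 < #|M|)%N by lia.
  by apply: hM SM _; apply: sub0set.
pose C := [set x in B | nbhd F x == B].
have CB : C \subset B by apply/subsetP => x; rewrite inE => /andP[].
have gout y : y \in B -> (g <= outdeg F B y + deg M y)%N.
  by move=> yB; have := deg_missing_closed cB yB; rewrite -/B -/M; lia.
have gC x : x \in C -> (g <= deg M x)%N.
  rewrite inE => /andP[xB /eqP Nx]; have := gout x xB.
  by have := outdeg_closed x; rewrite Nx => ->.
have x0C : x0 \in C by rewrite inE x0B eqxx.
(* At most half of [M] passes through [x0], so [2 * g <= #|M| = g + r]. *)
have gr : (g <= r)%N.
  by have := deg_le_half x0 hM; have := gC _ x0C; lia.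
have openy y : y \in B :\: C -> (0 < outdeg F B y)%N.
  case/setDP => yB yC; apply: outdeg_open => //.
  by apply: contra yC => Ny; rewrite inE yB.
have sO (S : {set T}) (w : rat) : S \subset B -> (forall y, y \in S -> w <= outweight F B y) ->
    #|S|%:R * w <= \sum_(v in B) outweight F B v.
  move=> SB wS; rewrite mulr_natl -sumr_const [X in _ <= X](big_setID S) /= (setIidPr SB).
  rewrite -[X in X <= _]addr0; apply: lerD; first exact: ler_sum.
  by apply: sumr_ge0 => v _; apply: outweight_ge0.
have cO : (#|B :\: C| + #|C| = d)%N.
  by rewrite -cB -(cardsID C B) (setIidPr CB) addnC.
have [Ou|uO] := leqP (2 * g) (#|B :\: C| + (r.+1 == d)).
  have hO y : y \in B :\: C -> 2%:R^-1 <= outweight F B y.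
    by move=> yO; apply: outweight_ge_half => //; [case/setDP: yO | apply: openy].
  have := sO _ _ (subsetDl _ _) hO; move: Ou; rewrite -(ler_nat rat) natrM natrD.
  by case: (r.+1 == d); rewrite /half_if /=; lra.
have Ck : #|C|%:R * wt inv1 g + 1 <= #|M|%:R by apply: card_ge_wt.
have g18 : (18 <= g)%N.
  have w1 : 1 <= wt inv1 g.
    by apply: le_trans (wt_mono inv1_ge0 g0); rewrite wt_inv1_1.
  (* If [r.+1 = d], one vertex of [C] is set aside: its weight of at least 1 in [M] replaces the
     slack that [r.+2 <= d] gives otherwise. *)
  have dr : (r.+1 == d) || (r.+2 <= d)%N by lia.
  case/orP: dr uO => [/eqP rde|rd2] uO.
    apply: (@needed_ge18 d #|C|.-1) => //; first by move: uO; rewrite rde eqxx; lia.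
    have : #|C|%:R = #|C|.-1%:R + 1 :> rat.
      by rewrite natr1 prednK //; apply/card_gt0P; exists x0.
    have : r%:R + 1 = d%:R :> rat by rewrite natr1 rde.
    by move=> er ec; move: Ck; rewrite Ng natrD ec; lra.
  apply: (@needed_ge18 d #|C|) => //.
    by move: uO; rewrite ltn_eqF /=; lia.
  move: Ck; rewrite Ng natrD.
  have : r%:R + 2%:R <= d%:R :> rat by rewrite -natrD ler_nat; lia.
  lra.
(* [H] is small since [M] is; a vertex of [B] outside [H] has at least ten outer sets. *)
pose H := [set v in B | g - 9 <= deg M v]%N.
have HB : H \subset B by apply/subsetP => x; rewrite inE => /andP[].
have Hk : #|H|%:R * wt inv1 (g - 9) + 1 <= #|M|%:R.
  by apply: card_ge_wt => // v; rewrite inE => /andP[].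
have H4 : (4 * #|H| + 1 <= #|M|)%N.
  rewrite -(ler_nat rat) natrD natrM; apply: le_trans Hk; rewrite lerD2r mulrC.
  apply: ler_wpM2l => //; apply: le_trans wt_inv1_9 _; apply: wt_mono inv1_ge0 _; lia.
have hH y : y \in B :\: H -> 2%:R <= outweight F B y.
  case/setDP => yB; rewrite inE yB /= -ltnNge => yH.
  by apply: outweight_ge2 => //; have := gout y yB; lia.
have := sO _ _ (subsetDl _ _) hH.
have cH : (#|B :\: H| + #|H| = d)%N.
  by rewrite -cB -(cardsID H B) (setIidPr HB) addnC.
have : (g <= 2 * #|B :\: H|)%N by lia.
rewrite -(ler_nat rat) natrM; lra.
Qed.
Lemma card_missing_closed x : #|nbhd F x| = d -> (#|missing F (nbhd F x)| <= 2 * r)%N.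
Proof.
move=> cB; have := deg_missing_closed cB (mem_nbhd x).
rewrite outdeg_closed; have := deg_le_half x (@missing_hereditary _ F (nbhd F x) hF); lia.
Qed.

(** * Overlapping blocks and discharging *)

Definition pair_link (x y : T) := [set A in F | (x \in A) && (y \in A)].

(** For [y] other than [x], the members through [x] avoiding [y] live on [d - 1] points, so there
    are at most [2 ^ d.-2] of them. *)
Lemma pair_link_ge x y : #|nbhd F x| = d -> y \in nbhd F x ->
  (2 ^ d.-2 <= #|pair_link x y| + r)%N.
Proof.
move=> cB yB; have h4 : (2 ^ d.-1 = 2 * 2 ^ d.-2)%N by rewrite -expnS; congr (_ ^ _)%N; lia.
have [<-|xy] := eqVneq x y.
  have -> : pair_link x x = [set A in F | x \in A].
    by apply/setP => A; rewrite !inE andbb.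
  by have := degF x; rewrite /deg; lia.
pose F' := [set A in F | y \notin A].
have hF' : hereditary F'.
  move=> A B; rewrite !inE => /andP[AF yA] BA; rewrite (hF AF BA) /=.
  by apply: contra yA; apply: (subsetP BA).
have dE : deg F x = (#|pair_link x y| + deg F' x)%N.
  rewrite /deg -(cardsID [set A : {set T} | y \in A]); congr (_ + _)%N; apply: eq_card => A;
    by rewrite !inE; case: (A \in F); case: (x \in A); case: (y \in A).
have N' : nbhd F' x \subset nbhd F x :\ y.
  apply/subsetP => z; rewrite !inE negb_or => /andP[-> /andP[_ yz]].
  by rewrite andbT eq_sym.
have := subset_leq_card N'; have := cardsD1 y (nbhd F x); rewrite yB cB => e1 e2.
have := deg_le_nbhd x hF'; have := degF x.
have : (2 ^ #|nbhd F' x|.-1 <= 2 ^ d.-2)%N by rewrite leq_exp2l //; lia.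
lia.
Qed.

(** Members through both vertices lie in both neighbourhoods. If these differed, their intersection
    would have fewer than [d] points and allow at most [2 ^ (d - 3)] such members, against
    [pair_link_ge]. *)
Lemma closed_adjacent x y : #|nbhd F x| = d -> #|nbhd F y| = d -> y \in nbhd F x ->
  nbhd F x = nbhd F y.
Proof.
move=> cx cy yx; have [-> //|xy] := eqVneq x y.
apply/eqP/negPn/negP => Nxy; pose D := nbhd F x :&: nbhd F y.
have cD : (#|D| < d)%N.
  rewrite -cx; apply: proper_card; rewrite properEneq subsetIl andbT.
  apply: contra Nxy => /eqP/setIidPl xsy; by rewrite eqEcard xsy cx cy leqnn.
have xD : x \in D by rewrite /D in_setI mem_nbhd /=; move: yx; rewrite !inE setUC.
have yD : y \in D by rewrite /D in_setI mem_nbhd andbT.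
have : (#|pair_link x y| <= 2 ^ #|D :\ x :\ y|)%N.
  rewrite -card_powerset.
  apply: leq_trans (leq_imset_card (fun S => x |: (y |: S)) _).
  apply: subset_leq_card; apply/subsetP => A; rewrite inE => /and3P[AF xA yA].
  apply/imsetP; exists (A :\ x :\ y); last first.
    by rewrite setD1K ?setD1K // !inE yA eq_sym xy.
  rewrite inE; apply: setSD; apply: setSD; rewrite subsetI.
  by rewrite (sub_nbhd hF AF xA) (sub_nbhd hF AF yA).
have e1 : #|D| = #|D :\ x|.+1 by rewrite [LHS](cardsD1 x) xD.
have e2 : #|D :\ x| = #|D :\ x :\ y|.+1.
  by rewrite [LHS](cardsD1 y) in_setD1 yD eq_sym xy.
have := pair_link_ge cx yx.
have : (2 ^ #|D :\ x :\ y| <= 2 ^ d.-2.-1)%N by rewrite leq_exp2l //; lia.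
have : (2 ^ d.-2 = 2 * 2 ^ d.-2.-1)%N by rewrite -expnS; congr (_ ^ _)%N; lia.
move: rsmall; nia.
Qed.

Definition blocks : {set {set T}} := [set B : {set T} | (#|B| == d) && [exists x, nbhd F x == B]].

Definition blocks_at (v : T) := [set B in blocks | v \in B].

Lemma in_blocks_at v B : (B \in blocks_at v) = (B \in blocks) && (v \in B).
Proof. by rewrite inE. Qed.

Lemma in_pair_link x y A : (A \in pair_link x y) = [&& A \in F, x \in A & y \in A].
Proof. by rewrite inE. Qed.

Lemma blockP (B : {set T}) : reflect (exists2 x, #|nbhd F x| = d & B = nbhd F x) (B \in blocks).
Proof.
rewrite inE; apply: (iffP andP) => [[/eqP cB /existsP[x /eqP e]]|[x cx ->]].
  by exists x; rewrite e.
by rewrite cx; split => //; apply/existsP; exists x.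
Qed.

(** The default [v] only makes the function total; for a block a vertex is always found. *)
Definition center (v : T) (B : {set T}) := odflt v [pick x | nbhd F x == B].

Lemma nbhd_center v B : B \in blocks -> nbhd F (center v B) = B.
Proof.
case/blockP => x _ ->; rewrite /center; case: pickP => [y /eqP //|/(_ x)].
by rewrite eqxx.
Qed.

Lemma card_block B : B \in blocks -> #|B| = d.
Proof. by rewrite inE => /andP[/eqP]. Qed.

Lemma center_mem v B B' : B \in blocks -> B' \in blocks -> center v B \in B' -> B = B'.
Proof.
move=> bB bB'; rewrite -{1}(nbhd_center v bB') => cBB'.
rewrite -(nbhd_center v bB) -(nbhd_center v bB').
by apply/esym/closed_adjacent => //; rewrite nbhd_center // card_block.
Qed.

(* Sets through [v] and the centers of different blocks at [v] are different. *)
Lemma outweight_blocks v B1 : B1 \in blocks_at v ->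
  \sum_(B in blocks_at v :\ B1) \sum_(A in pair_link (center v B) v) #|A|%:R^-1
    <= outweight F B1 v.
Proof.
rewrite inE => /andP[bB1 vB1].
rewrite (exchange_big_dep (fun A => (A \in F) && (v \in A))) /=; last first.
  by move=> B A _; rewrite inE => /and3P[-> _ ->].
rewrite /outweight [X in _ <= X]big_mkcond /= big_mkcond /=.
apply: ler_sum => A _; case: ifP => [/andP[AF vA]|]; last by case: (A \in F) => //= ->.
rewrite AF vA /=.
have inv0 : 0 <= #|A|%:R^-1 :> rat by rewrite invr_ge0 ler0n.
case: (pickP (fun B => (B \in blocks_at v :\ B1) && (A \in pair_link (center v B) v))) => [B|no]; last first.
  by rewrite big_pred0 //; case: ifP.
case/andP; rewrite in_setD1 in_blocks_at in_pair_link => /andP[BB1 /andP[bB vB]] /and3P[_ cA _].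
have -> : ~~ (A \subset B1).
  by apply: contra BB1 => AB1; apply/eqP/(@center_mem v) => //; apply: (subsetP AB1).
rewrite (bigD1 B) /=; last by rewrite in_setD1 in_blocks_at in_pair_link BB1 bB vB AF cA vA.
rewrite big1 ?addr0 // => B' /andP[/andP[]].
rewrite in_setD1 in_blocks_at in_pair_link => /andP[_ /andP[bB' _]] /and3P[_ cA' _] /eqP[].
apply/esym/(@center_mem v) => //; rewrite -(nbhd_center v bB').
by apply: (subsetP (sub_nbhd hF AF cA')).
Qed.

(** At most [2 * r] subsets of [B1] are absent, each costing at most 1. Every further block at [v]
    brings at least [(2 ^ d.-2 - r) / d] from sets leaving [B1], far more than all debts. *)
Lemma weight_many_blocks v : (2 <= #|blocks_at v|)%N ->
  (2 ^+ d - 1 - r%:R) / d%:R + #|blocks_at v|%:R * d%:R <= weight F v.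
Proof.
move=> t2; have /card_gt0P[B1 B1v] : (0 < #|blocks_at v|)%N by lia.
have [bB1 vB1] : B1 \in blocks /\ v \in B1 by move: B1v; rewrite inE => /andP.
have := outweight_blocks B1v; set s := \sum_(B in _) _ => sow.
have d0 : 0 < d%:R :> rat by rewrite ltr0n; lia.
have hs : (#|blocks_at v|%:R - 1) * ((2 ^ d.-2)%:R - r%:R) / d%:R <= s.
  have -> : #|blocks_at v|%:R - 1 = #|blocks_at v :\ B1|%:R :> rat.
    by rewrite (cardsD1 B1) B1v natrD addrAC subrr add0r.
  rewrite -mulrA mulr_natl -sumr_const; apply: ler_sum => B; rewrite in_setD1 in_blocks_at => /andP[_ /andP[bB vB]].
  have nB := nbhd_center v bB; have cB := card_block bB.
  apply: (@le_trans _ _ (\sum_(A in pair_link (center v B) v) d%:R^-1)).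
    rewrite sumr_const -[X in _ <= X]mulr_natl ler_pM2r ?invr_gt0 //.
    rewrite lerBlDr -natrD ler_nat; apply: pair_link_ge; by rewrite nB.
  apply: ler_sum => A; rewrite in_pair_link => /and3P[AF cA vA].
  rewrite lef_pV2 ?posrE // ?ler_nat.
    by rewrite -cB -nB; apply: subset_leq_card; apply: sub_nbhd.
  by rewrite ltr0n; apply/card_gt0P; exists v.
pose FB := [set A in F | A \subset B1].
have hFB : hereditary FB.
  move=> A B; rewrite !inE => /andP[AF AB] BA.
  by rewrite (hF AF BA) (subset_trans BA AB).
have wE : weight F v = weight FB v + outweight F B1 v.
  rewrite /weight (bigID (fun A : {set T} => A \subset B1)) /=; congr (_ + _).
    by apply: eq_bigl => A; rewrite !inE andbAC.
  by apply: eq_bigl => A; rewrite -andbA.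
have dFB : (2 ^ d.-1 <= deg FB v + 2 * r)%N.
  have := card_missing_at F vB1; rewrite (card_block bB1).
  have -> : #|[set A in F | (v \in A) && (A \subset B1)]| = deg FB v.
    by apply: eq_card => A; rewrite !inE andbAC andbA.
  have := card_missing_closed (x := center v B1); rewrite nbhd_center // => /(_ (card_block bB1)).
  have : (#|[set S in missing F B1 | v \notin S]| <= #|missing F B1|)%N.
    by apply: subset_leq_card; apply/subsetP => S; rewrite inE => /andP[].
  lia.
have wFB : (2 ^+ d - 1) / d%:R <= weight FB v + 2%:R * r%:R.
  have e2 : d.-1.+1 = d by lia.
  have := wt_inv1_pow2 d.-1; rewrite e2 => <-.
  apply: (@le_trans _ _ (wt inv1 (deg FB v + 2 * r))).
    by apply: wt_mono inv1_ge0 _.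
  apply: (@le_trans _ _ (wt inv1 (deg FB v) + (2 * r)%N%:R * 1)).
    apply: wt_tail => i _; by rewrite /inv1 invf_le1 ?ltr0n // ler1n.
  by rewrite mulr1 natrM lerD2r; apply: weight_ge.
have tR : 2%:R <= #|blocks_at v|%:R :> rat by rewrite ler_nat.
have key : #|blocks_at v|%:R * d%:R + 2%:R * r%:R <= s.
  apply: le_trans hs; rewrite ler_pdivlMr //.
  have e1 : 4%:R * d%:R * d%:R <= (2 ^ d.-2)%:R - r%:R :> rat.
    by rewrite lerBrDr -!natrM -natrD ler_nat; move: rsmall; nia.
  have e3 : r%:R <= d%:R :> rat by rewrite ler_nat ltnW.
  apply: le_trans (_ : (#|blocks_at v|%:R - 1) * (4%:R * d%:R * d%:R) <= _); last first.
    apply: ler_wpM2l => //; lra.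
  move: (#|blocks_at v|%:R) tR => t tR; nra.
have rd0 : 0 <= r%:R / d%:R :> rat by rewrite divr_ge0 ?ler0n.
rewrite wE mulrBl; lra.
Qed.

(** The excess [weight F v - tau] is summed separately over the vertices covered by good blocks,
    where [weight_block] applies, and over the others by discharging. *)
Theorem card_hereditary_ge : (0 < #|T|)%N ->
  (2 ^+ d - 1 - r%:R - half_if (r.+1 == d)) / d%:R * #|T|%:R <= #|F|%:R - 1.
Proof.
case/card_gt0P => v0 _; rewrite -(sum_weight (set0_mem v0)).
have eps0 := half_if_ge0 (r.+1 == d); set eps := half_if _ in eps0 *.
set tau := (_ / _); have d0 : 0 < d%:R :> rat by rewrite ltr0n; lia.
have tau_le : tau <= (2 ^+ d - 1 - r%:R) / d%:R.
  by rewrite /tau ler_pM2r ?invr_gt0 //; lra.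
rewrite mulr_natr -sumr_const -subr_ge0 -sumrB.
(* A good block shares no vertex with another block, so the good blocks are disjoint and no bad
   block meets them. *)
pose good := [set B in blocks | [forall (v | v \in B), #|blocks_at v| <= 1]%N].
pose bad_at v := blocks_at v :\: good.
have bad_out v : v \in cover good -> bad_at v = set0.
  case/bigcupP => B; rewrite inE => /andP[bB /forall_inP Bv] vB.
  apply/eqP; rewrite setD_eq0; apply/subsetP => B'; rewrite in_blocks_at => /andP[bB' vB'].
  have -> : B' = B.
    by apply: (card_le1_eqP (Bv v vB)); rewrite in_blocks_at ?bB ?bB'.
  by rewrite inE bB; apply/forall_inP.
have trivg : trivIset good.
  apply/trivIsetP => B B'; rewrite inE => /andP[bB /forall_inP Bv]; rewrite inE => /andP[bB' _] /=.
  apply: contraR; rewrite -setI_eq0 => /set0Pn[v]; rewrite inE => /andP[vB vB'].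
  by apply/eqP; apply: (card_le1_eqP (Bv v vB)); rewrite in_blocks_at ?bB ?bB'.
have goodS : 0 <= \sum_(v in cover good) (weight F v - tau).
  rewrite big_trivIset //; apply: sumr_ge0 => B; rewrite inE => /andP[bB _].
  case/blockP: bB => x cx ->; rewrite sumrB sumr_const cx -[_ *+ _]mulr_natr.
  by rewrite divfK ?gt_eqF // subr_ge0; apply: weight_block.
(* Discharging: every vertex of a bad block pays [kappa] to each bad block at it. *)
pose kappa v : rat := if (2 <= #|blocks_at v|)%N then d%:R - 1 else -1.
have omega v : v \notin cover good -> kappa v * #|bad_at v|%:R <= weight F v - tau.
  move=> vg; rewrite /kappa; case: ifP => t2.
    have := weight_many_blocks t2.
    have : #|bad_at v|%:R <= #|blocks_at v|%:R :> rat.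
      by rewrite ler_nat; apply: subset_leq_card; apply: subsetDl.
    have : 0 <= #|bad_at v|%:R :> rat by rewrite ler0n.
    move: (#|bad_at v|%:R) (#|blocks_at v|%:R) d0 => x y; nra.
  (* With exactly [d] neighbours the loss is at most [1/6], and the own neighbourhood is a bad block
     whose credit of 1 covers it. With more neighbours there is no loss. *)
  have := weight_nbhd d50 rd hF (degF v); have := card_nbhd_ge v.
  rewrite leq_eqVlt => /predU1P[dN|dN] wN.
    have : (0 < #|bad_at v|)%N.
      apply/card_gt0P; exists (nbhd F v).
      have bN : nbhd F v \in blocks by apply/blockP; exists v.
      rewrite in_setD in_blocks_at bN mem_nbhd !andbT.
      by apply: contra vg => gN; apply/bigcupP; exists (nbhd F v) => //; apply: mem_nbhd.
    rewrite -(ler_nat rat) => b1; rewrite -dN in wN; lra.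
  have : 0 <= #|bad_at v|%:R :> rat by rewrite ler0n.
  have : d%:R + 1 <= #|nbhd F v|%:R :> rat by rewrite natr1 ler_nat.
  lra.
rewrite (bigID (fun v => v \in cover good)) /=; apply: addr_ge0.
  by rewrite (eq_bigl (fun v => v \in cover good)).
apply: (@le_trans _ _ (\sum_(v | v \notin cover good) kappa v * #|bad_at v|%:R)); last first.
  exact: ler_sum.
have -> : \sum_(v | v \notin cover good) kappa v * #|bad_at v|%:R
    = \sum_v \sum_(B in bad_at v) kappa v.
  rewrite [RHS](bigID (fun v => v \in cover good)) /= [X in _ = X + _]big1 ?add0r.
    by apply: eq_bigr => v _; rewrite sumr_const -[RHS]mulr_natr.
  by move=> v /bad_out ->; rewrite big_set0.
rewrite (exchange_big_dep (fun B => B \in blocks :\: good)) /=; last first.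
  by move=> v B _; rewrite !in_setD in_blocks_at => /and3P[-> -> _].
apply: sumr_ge0 => B; rewrite in_setD => /andP[Bg bB].
rewrite (eq_bigl (fun v => v \in B)); last first.
  by move=> v; rewrite in_setD in_blocks_at Bg bB.
(* One vertex in several blocks pays [d - 1] to the bad block, which balances the at most 1 drawn by
   each of its other [d - 1] vertices. *)
have [v vB t2] : exists2 v, v \in B & (2 <= #|blocks_at v|)%N.
  move: Bg; rewrite inE bB /= negb_forall => /existsP[v]; rewrite negb_imply -ltnNge => /andP[vB t2].
  by exists v.
have kge u : -1 <= kappa u.
  rewrite /kappa; case: ifP => // _; lra.
rewrite (bigD1 v) //= {1}/kappa t2.
have : \sum_(i in B | i != v) (-1 : rat) <= \sum_(i in B | i != v) kappa i.
  exact: ler_sum.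
rewrite sumr_const mulNrn.
have -> : #|(fun i => (i \in B) && (i != v))| = #|B :\ v|.
  by apply: eq_card => i; rewrite [RHS]in_setD1 andbC.
have : d%:R = 1 + #|B :\ v|%:R :> rat.
  by rewrite -(card_block bB) (cardsD1 v) vB natrD.
move=> ->; lra.
Qed.

End MinDegree.

(** * Bounds on [mns] *)

Lemma exists_subset_card (T : finType) (A : {set T}) k : (k <= #|A|)%N ->
  exists2 B : {set T}, B \subset A & #|B| = k.
Proof.
move=> kA; have : (0 < #|[set B : {set T} | B \subset A & #|B| == k]|)%N.
  by rewrite cards_draws bin_gt0.
by case/card_gt0P => B; rewrite inE => /andP[BA /eqP cB]; exists B.
Qed.

Lemma card_restr_sub (T : finType) (F F' : {set {set T}}) (S : {set T}) :
  F \subset F' -> (#|restr F S| <= #|restr F' S|)%N.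
Proof. by move=> FF'; apply: subset_leq_card; apply: imsetS. Qed.

Lemma arrow_of_hereditary n m s :
  (forall G : {set {set 'I_n}}, hereditary G -> #|G| = m -> exists v, (deg G v <= s)%N) ->
  arrow n m n.-1 (m - s).
Proof.
move=> Hm; apply/forallP => FF; apply/implyP => mF.
have [F FFF cF] := exists_subset_card mF.
have [G [hG cG rG]] := exists_compression F.
have [v dv] := Hm G hG (etrans cG cF).
apply/existsP; exists (~: [set v]); rewrite cardsC1 card_ord eqxx /=.
rewrite leq_subLR -cF -cG -(card_restr_hereditary v hG) addnC; apply: leq_add => //.
exact: leq_trans (rG _) (card_restr_sub _ FFF).
Qed.

Lemma mns_ge n s m : (m <= 2 ^ n)%N -> arrow n m n.-1 (m - s) -> (m <= mns n s)%N.
Proof.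
rewrite -ltnS => m2 am; exact: (@leq_bigmax_cond _ _ (fun i => nat_of_ord i) (Ordinal m2) am).
Qed.

(** For larger [m], pad [G] to size [m] with arbitrary sets [D]: deleting any [v] still loses more
    than [s], since [D] adds at most [#|D|] traces. The range [m <= 2 ^ n] leaves room for [D]. *)
Lemma mns_lt n s (G : {set {set 'I_n}}) : (0 < n)%N -> hereditary G ->
  (forall v, s < deg G v)%N -> (mns n s <= #|G|.-1)%N.
Proof.
move=> n0 hG dG; apply/bigmax_leqP => -[m /= m2] /forallP am.
rewrite leqNgt; apply/negP => Gm.
have [D DG cD] : exists2 D : {set {set 'I_n}}, D \subset ~: G & #|D| = (m - #|G|)%N.
  apply: exists_subset_card; rewrite (cardsCs (~: G)) setCK -[X in (_ <= X - _)%N]cardsT -powersetT card_powerset cardsT card_ord.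
  by apply: leq_sub2r; rewrite -ltnS.
have GD : [disjoint G & D] by rewrite disjoint_sym disjoints_subset.
have cGD : #|G :|: D| = m.
  by rewrite cardsU disjoint_setI0 // cards0 subn0 cD subnKC //; move: Gm; case: #|G|.
have := implyP (am (G :|: D)); rewrite cGD leqnn => /(_ isT) /existsP[T /andP[/eqP cT mT]].
have /eqP/cards1P[v Tv] : #|~: T| = 1%N.
  by rewrite cardsCs setCK cT card_ord; lia.
have TE : T = ~: [set v] by rewrite -Tv setCK.
have tU : (#|trace (G :|: D) T| <= #|restr G T| + #|D|)%N.
  rewrite /trace imsetU; apply: leq_trans (leq_card_setU _ _) _.
  by rewrite leq_add2l; apply: leq_imset_card.
have := card_restr_hereditary v hG; rewrite -TE; have := dG v.
have := leq_trans mT tU; rewrite cD; move: Gm; move: #|restr _ _| #|G| => x y; lia.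
Qed.

(** * Glued copies of a family *)

(** The copies may overlap. The empty set is split off so that it is counted once and not once per
    copy. *)
Definition glue (U V I : finType) (H : {set {set U}}) (f : I -> U -> V) : {set {set V}} :=
  set0 |: \bigcup_i [set f i @: (A : {set U}) | A in H :\ set0].

Lemma mem_glue (U V I : finType) (H : {set {set U}}) (f : I -> U -> V) i (A : {set U}) :
  A \in H -> f i @: A \in glue H f.
Proof.
move=> AH; rewrite !inE; have [->|A0] := eqVneq A set0; first by rewrite imset0 eqxx.
by apply/orP; right; apply/bigcupP; exists i => //; apply: imset_f; rewrite !inE A0.
Qed.

Lemma glueP (U V I : finType) (H : {set {set U}}) (f : I -> U -> V) B :
  B \in glue H f -> B = set0 \/ exists i, exists2 A : {set U}, A \in H & B = f i @: A.
Proof.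
rewrite !inE => /orP[/eqP|/bigcupP[i _ /imsetP[A]]]; first by left.
by rewrite !inE => /andP[_ AH] ->; right; exists i, A.
Qed.

Lemma glue_hereditary (U V I : finType) (H : {set {set U}}) (f : I -> U -> V) :
  hereditary H -> hereditary (glue H f).
Proof.
move=> hH A B /glueP[->|[i [C CH ->]]] BA.
  by move: BA; rewrite subset0 => /eqP ->; rewrite !inE eqxx.
have -> : B = f i @: (C :&: f i @^-1: B).
  apply/setP => v; apply/idP/imsetP => [vB|[u]]; last by rewrite !inE => /andP[_ fB] ->.
  have /imsetP[u uC vu] := subsetP BA _ vB.
  by exists u => //; rewrite !inE uC -vu.
by apply: mem_glue; apply: hH CH _; apply: subsetIl.
Qed.

Lemma card_glue (U V I : finType) (H : {set {set U}}) (f : I -> U -> V) :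
  set0 \in H -> (#|glue H f| <= (#|I| * #|H|.-1).+1)%N.
Proof.
move=> H0; rewrite /glue; apply: leq_trans (leq_card_setU _ _) _.
rewrite cards1 add1n ltnS -sum_nat_const.
apply: leq_trans (_ : \sum_i #|[set f i @: (A : {set U}) | A in H :\ set0]| <= _)%N.
  elim/big_rec2: _ => [|i x y _ h]; first by rewrite cards0.
  by apply: leq_trans (leq_card_setU _ _) _; rewrite leq_add2l.
apply: leq_sum => i _; apply: leq_trans (leq_imset_card _ _) _.
by rewrite [X in (_ <= X.-1)%N](cardsD1 set0) H0.
Qed.

Lemma deg_glue (U V I : finType) (H : {set {set U}}) (f : I -> U -> V) i u :
  injective (f i) -> (deg H u <= deg (glue H f) (f i u))%N.
Proof.
move=> fi; rewrite /deg -(card_imset _ (imset_inj fi)); apply: subset_leq_card.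
apply/subsetP => _ /imsetP[A AH ->]; move: AH; rewrite inE => /andP[AH uA].
by rewrite inE mem_glue //= imset_f.
Qed.

(** Copies of [H] are placed on consecutive windows of length [#|U|], the last one wrapping around
    modulo [n]; the rounded-up quotient many windows cover all vertices. *)
Lemma mns_le_gadget (U : finType) (H : {set {set U}}) s n :
  hereditary H -> set0 \in H -> (forall u, s < deg H u)%N -> (0 < #|U| <= n)%N ->
  (mns n s <= (n + #|U|.-1) %/ #|U| * #|H|.-1)%N.
Proof.
case: n => [|n]; first by case: #|U|.
move=> hH H0 dH /andP[U0 Un].
pose f (i : 'I_((n.+1 + #|U|.-1) %/ #|U|)) (u : U) : 'I_n.+1 :=
  inord ((i * #|U| + enum_rank u) %% n.+1).
have fi i : injective (f i).
  move=> u u' /(congr1 val); rewrite /= !inordK ?ltn_mod // => /eqP.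
  rewrite eqn_modDl !modn_small ?(leq_trans (ltn_ord _) Un) // => /eqP/val_inj.
  exact: enum_rank_inj.
have := @mns_lt n.+1 s (glue H f) isT (glue_hereditary (f := f) hH).
move=> /(_ _)/leq_trans -> //; last first.
  by have := card_glue f H0; rewrite card_ord; case: #|glue H f|.
move=> v; have vi : (v %/ #|U| < (n.+1 + #|U|.-1) %/ #|U|)%N.
  have -> : (v %/ #|U|).+1 = ((v + #|U|) %/ #|U|)%N by rewrite divnDr ?divnn ?U0 ?addn1.
  by apply: leq_div2r; have := ltn_ord v; lia.
have vu : (v %% #|U| < #|U|)%N by rewrite ltn_mod.
have -> : v = f (Ordinal vi) (enum_val (Ordinal vu)).
  apply: val_inj; rewrite /f enum_valK /= -divn_eq modn_small ?inordK //.
apply: leq_trans (dH _) (deg_glue _ _ (fi _)).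
Qed.

(** * Extremal families *)

(** The Alexander dual: the family whose missing sets over the whole vertex set are [P]. *)
Definition codual (T : finType) (P : {set {set T}}) : {set {set T}} :=
  [set A : {set T} | ~: A \notin P].

Lemma codual_hereditary (T : finType) (P : {set {set T}}) :
  hereditary P -> hereditary (codual P).
Proof.
move=> hP A B; rewrite !inE => AP BA; apply: contra AP => BP.
by apply: hP BP _; rewrite setCS.
Qed.

Lemma missing_codual (T : finType) (P : {set {set T}}) : missing (codual P) setT = P.
Proof. by apply/setP => S; rewrite !inE subsetT setTD setCK negbK. Qed.

Lemma card_codual (T : finType) (P : {set {set T}}) : (#|codual P| + #|P| = 2 ^ #|T|)%N.
Proof.
have := card_missing (codual P) setT; rewrite missing_codual cardsT => <-.
by congr (_ + _)%N; apply: eq_card => A; rewrite !inE subsetT andbT.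
Qed.

Lemma deg_codual (T : finType) (P : {set {set T}}) y :
  (2 ^ #|T|.-1 + deg P y <= deg (codual P) y + #|P|)%N.
Proof.
have := deg_block (codual P) (in_setT y); rewrite missing_codual cardsT => ->; lia.
Qed.

(** As a family of missing sets it lowers degrees by [#|X|.+1], of which each point of [X] regains
    one. *)
Definition star (T : finType) (X : {set T}) : {set {set T}} :=
  set0 |: [set [set x] | x in X].

Lemma star_card_le1 (T : finType) (X S : {set T}) : S \in star X -> (#|S| <= 1)%N.
Proof. by rewrite !inE => /orP[/eqP ->|/imsetP[x _ ->]]; rewrite ?cards0 ?cards1. Qed.

Lemma star_hereditary (T : finType) (X : {set T}) : hereditary (star X).
Proof.
move=> A B; rewrite !inE => /orP[/eqP ->|/imsetP[x xX ->]].
  by rewrite subset0 => ->.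
rewrite subset1 => /orP[/eqP ->|->] //.
by rewrite imset_f ?orbT.
Qed.

Lemma card_star (T : finType) (X : {set T}) : #|star X| = #|X|.+1.
Proof.
rewrite /star cardsU1 (card_imset _ set1_inj).
suff -> : set0 \notin [set [set x] | x in X] by [].
by apply/imsetP => -[x _ /setP/(_ x)]; rewrite !inE eqxx.
Qed.

Lemma deg_star (T : finType) (X : {set T}) x : x \in X -> (0 < deg (star X) x)%N.
Proof.
by move=> xX; apply/card_gt0P; exists [set x]; rewrite !inE eqxx andbT imset_f ?orbT.
Qed.

(** A cube with [c - 1] missing sets: every degree drops by at most [c - 1]. *)
Lemma gadget_lt d c : (3 <= d)%N -> (0 < c < d)%N -> (c < 2 ^ d.-1)%N ->
  exists H : {set {set 'I_d}}, [/\ hereditary H, set0 \in H,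
    forall u, (2 ^ d.-1 - c < deg H u)%N & (#|H| + c = (2 ^ d).+1)%N].
Proof.
move=> d3 /andP[c0 cd] c2.
have [P [hP cP TP]] : exists P : {set {set 'I_d}},
    [/\ hereditary P, #|P| = c.-1 & setT \notin P].
  case: c c0 cd c2 => // -[|c] _ cd c2.
    by exists set0; split; rewrite ?cards0 ?inE // => A B; rewrite inE.
  have [X _ cX] : exists2 X : {set 'I_d}, X \subset setT & #|X| = c.
    by apply: exists_subset_card; rewrite cardsT card_ord; lia.
  exists (star X); split; [exact: star_hereditary | by rewrite card_star cX |].
  apply/negP => /star_card_le1; rewrite cardsT card_ord; lia.
exists (codual P); split.
- exact: codual_hereditary.
- by rewrite inE setC0.
- by move=> u; have := deg_codual P u; rewrite cP card_ord; lia.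
- have := card_codual P; rewrite cP card_ord; lia.
Qed.

(** Each of two cubes misses [d] sets, chosen as a star so that only [x0] falls one short of the
    required degree. The edge joining the two copies of [x0] repairs both at the price of one
    set. *)
Lemma gadget_eq d : (3 <= d)%N -> (d < 2 ^ d.-1)%N ->
  exists H : {set {set (bool * 'I_d)}}, [/\ hereditary H, set0 \in H,
    forall u, (2 ^ d.-1 - d < deg H u)%N & (#|H| + 2 * d <= 2 ^ d.+1)%N].
Proof.
case: d => // d d3 d2.
pose x0 : 'I_d.+1 := ord0; pose P := star (~: [set x0]).
have cP : #|P| = d.+1 by rewrite card_star cardsC1 card_ord.
pose H0 := codual P; pose f (b : bool) (u : 'I_d.+1) := (b, u).
have fi b : injective (f b) by move=> u u' [].
have hH0 : hereditary H0 by apply: codual_hereditary; apply: star_hereditary.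
have H00 : set0 \in H0.
  by rewrite inE setC0; apply/negP => /star_card_le1; rewrite cardsT card_ord; lia.
have dH0 u : (2 ^ d + (u != x0) <= deg H0 u + d.+1)%N.
  have := deg_codual P u; rewrite cP card_ord -/H0 /=.
  have [_|ux] := eqVneq u x0; first by rewrite addn0; apply: leq_trans; apply: leq_addr.
  have := @deg_star _ (~: [set x0]) u; rewrite !inE ux => /(_ isT) u1.
  by apply: leq_trans; rewrite leq_add2l.
pose G := glue H0 f; have hG : hereditary G by apply: glue_hereditary.
have dG b u : (deg H0 u <= deg G (b, u))%N by apply: (@deg_glue _ _ _ H0 f b).
pose e := [set (true, x0); (false, x0)].
have eG : e \notin G.
  apply/negP => /glueP[/setP/(_ (true, x0))|[b [A _ /setP eA]]]; first by rewrite !inE eqxx.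
  have := eA (~~ b, x0); rewrite !inE; have -> : ((~~ b, x0) \in f b @: A) = false.
    by apply/imsetP => -[u _ [bb _]]; case: b bb {eA}.
  by case: b {eA}; rewrite ?eqxx ?orbT.
have G1 p : [set p] \in G.
  have : (0 < deg G p)%N by case: p => b u; have := dG b u; have := dH0 u; move: d2 => /=; lia.
  by case/card_gt0P => A; rewrite inE => /andP[AG pA]; apply: hG AG _; rewrite sub1set.
have cG : (#|G| <= (2 * #|H0|.-1).+1)%N by have := card_glue f H00; rewrite card_bool.
clearbody G; exists (e |: G); split.
- move=> A B; rewrite !in_setU1 => /predU1P[->|AG] BA; last by rewrite (hG _ _ AG BA) orbT.
  have [//|Be] := eqVneq B e; rewrite /=.
  have [eB|] := boolP ((true, x0) \in B); last first.
    move=> nB; apply: (hG _ _ (G1 (false, x0))); apply/subsetP => p pB.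
    have := subsetP BA p pB; rewrite !inE => /orP[/eqP pe|//].
    by rewrite -pe pB in nB.
  have nB : (false, x0) \notin B.
    apply: contra Be => fB; rewrite eqEsubset BA; apply/subsetP => p.
    by rewrite !inE => /orP[] /eqP ->.
  apply: (hG _ _ (G1 (true, x0))); apply/subsetP => p pB.
  have := subsetP BA p pB; rewrite !inE => /orP[//|/eqP pe].
  by rewrite -pe pB in nB.
- by rewrite in_setU1 (hG _ _ (G1 (true, x0))) ?sub0set ?orbT.
- case=> b u; have h1 := dG b u; have h2 := dH0 u.
  have dE : deg (e |: G) (b, u) = ((u == x0) + deg G (b, u))%N.
    rewrite /deg.
    have [ux|ux] := eqVneq u x0.
      have -> : [set A in e |: G | (b, u) \in A] = e |: [set A in G | (b, u) \in A].
        apply/setP => A; rewrite !inE; have [->|//] := eqVneq A e.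
        by rewrite !inE ux; case: (b); rewrite ?eqxx ?orbT.
      by rewrite cardsU1 !inE (negbTE eG).
    rewrite add0n; apply: eq_card => A; rewrite !inE; have [->|//] := eqVneq A e.
    by rewrite (negbTE eG) !inE !xpair_eqE (negbTE ux) !andbF.
  rewrite dE; move: h1 h2 d2; rewrite /=; move: (deg G _) (deg H0 u) (2 ^ d)%N => x y z.
  by case: (u == x0) => /=; lia.
- rewrite cardsU1 eG (expnS 2 d.+1); move: cG.
  have h0 : (0 < #|H0|)%N by apply/card_gt0P; exists set0.
  have := card_codual P; rewrite cP card_ord -/H0; move: h0.
  move: #|G| #|H0| (2 ^ d.+1)%N => x y z /=; lia.
Qed.

(** * Matching bounds and the limit *)

Lemma mns_ge_tau d r n m : (50 <= d)%N -> (r < d)%N -> (d <= n)%N ->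
  m%:R <= (2 ^+ d - 1 - r%:R - half_if (r.+1 == d)) / d%:R * n%:R :> rat ->
  (m <= mns n (2 ^ d.-1 - r.+1))%N.
Proof.
move=> d50 rd dn mtau; have n0 : (0 < #|'I_n|)%N by rewrite card_ord; lia.
have lower (G : {set {set 'I_n}}) : hereditary G ->
    (forall v, 2 ^ d.-1 <= deg G v + r)%N -> (m < #|G|)%N.
  move=> hG dG; have := card_hereditary_ge d50 rd hG dG n0; rewrite card_ord.
  by move/(le_trans mtau); rewrite lerBrDr natr1 ler_nat.
apply: mns_ge.
  (* The range in [mns] demands [m <= 2 ^ n]; this follows from [lower] for the full cube. *)
  have := lower setT; rewrite -powersetT card_powerset cardsT card_ord => lT.
  apply/ltnW/lT => [A B _ _|v]; first by rewrite powersetT inE.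
  have -> : deg (powerset [set: 'I_n]) v = (2 ^ n.-1)%N.
    have := card_missing_at (powerset setT) (in_setT v).
    rewrite cardsT card_ord => <-; rewrite -[LHS]addn0; congr (_ + _)%N.
      by apply: eq_card => A; rewrite !inE subsetT andbT.
    by apply/esym/eqP; rewrite cards_eq0; apply/eqP/setP => S; rewrite !inE !subsetT.
  by apply: leq_trans (leq_addr _ _); rewrite leq_exp2l //; lia.
apply: arrow_of_hereditary => G hG cG; apply/existsP; apply: contraLR isT.
rewrite negb_exists => /forallP dG; have := lower G hG; rewrite cG ltnn; apply=> v.
have := dG v; rewrite -ltnNge; lia.
Qed.

(** The bounds place [mns n s] between [K n / D - 1] and [K n / D + K], so after division by [n] the
    error is at most [(K + 1) / n]; they coincide when [D] divides [n]. *)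
Lemma ms_of_bounds s D K : (0 < D)%N ->
  (forall n, (D <= n)%N -> (mns n s <= (n + D.-1) %/ D * K)%N) ->
  (forall n m, (D <= n)%N -> (m * D <= K * n)%N -> (m <= mns n s)%N) ->
  (forall n, (0 < n)%N -> (D %| n)%N -> (mns n s)%:R = (K%:R / D%:R) * n%:R :> rat)
  /\ ms_eq s (K%:R / D%:R).
Proof.
move=> D0 up low; have DR : 0 < D%:R :> rat by rewrite ltr0n.
split=> [n n0 Dn|eps eps0].
  have [q nE] := dvdnP Dn; rewrite {}nE in n0 Dn *.
  have Dq : (D <= q * D)%N by apply: leq_pmull; move: n0; rewrite muln_gt0 => /andP[].
  have -> : mns (q * D) s = (q * K)%N.
    apply/eqP; rewrite eqn_leq low ?andbT //; last by rewrite mulnAC [(K * _)%N]mulnC.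
    by apply: leq_trans (up _ Dq) _; rewrite divnMDl // divn_small ?addn0 // ltn_predL.
  by rewrite !natrM [RHS]mulrCA divfK ?gt_eqF.
have K0 : 0 <= K.+1%:R / eps by rewrite divr_ge0 ?ler0n ?ltW.
exists (D + Num.bound (K.+1%:R / eps))%N => n nN.
have Dn : (D <= n)%N by lia.
have nR : 0 < n%:R :> rat by rewrite ltr0n; lia.
have Kn : K.+1%:R / n%:R < eps.
  rewrite ltr_pdivrMr // mulrC -ltr_pdivrMr //; apply: lt_le_trans (archi_boundP K0) _.
  by rewrite ler_nat; lia.
apply: le_lt_trans Kn; rewrite -[K.+1%:R]natr1.
have h1 : (mns n s)%:R * D%:R <= (n%:R + D%:R) * K%:R :> rat.
  rewrite -natrM -natrD -natrM ler_nat; apply: leq_trans (_ : (n + D.-1) %/ D * K * D <= _)%N.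
    by rewrite leq_mul2r up // orbT.
  rewrite mulnAC leq_mul2r; apply/orP; right; apply: leq_trans (leq_trunc_div _ _) _.
  by rewrite leq_add2l leq_pred.
have h2 : K%:R * n%:R <= ((mns n s)%:R + 1) * D%:R :> rat.
  rewrite natr1 -!natrM ler_nat; apply: leq_trans (ltnW (ltn_ceil (K * n) D0)) _.
  by rewrite leq_mul2r ltnS low ?orbT // leq_trunc_div.
have -> : (mns n s)%:R / n%:R - K%:R / D%:R =
    ((mns n s)%:R * D%:R - K%:R * n%:R) / D%:R / n%:R :> rat.
  by field; rewrite !gt_eqF.
rewrite normrM [X in _ * X]ger0_norm ?invr_ge0 ?ler0n // ler_pM2r ?invr_gt0 //.
rewrite ler_norml; apply/andP; split.
  rewrite ler_pdivlMr //; have : 0 <= K%:R * D%:R :> rat by rewrite mulr_ge0 ?ler0n.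
  lra.
rewrite ler_pdivrMr //; lra.
Qed.

Theorem mainTheorem2 (d : nat) (hd : (50 <= d)%N) :
  ((forall n : nat, (0 < n)%N -> (2 * d %| n)%N ->
      (mns n (2 ^ d.-1 - d)%N)%:R =
        ((2%:R ^+ d - d%:R - 1 / 2%:R) / d%:R) * n%:R :> rat)
   /\ ms_eq (2 ^ d.-1 - d)%N ((2%:R ^+ d - d%:R - 1 / 2%:R) / d%:R))
  /\
  (forall c : nat, (1 <= c)%N -> (c <= d.-1)%N ->
     (forall n : nat, (0 < n)%N -> (d %| n)%N ->
        (mns n (2 ^ d.-1 - c)%N)%:R =
          ((2%:R ^+ d - c%:R) / d%:R) * n%:R :> rat)
     /\ ms_eq (2 ^ d.-1 - c)%N ((2%:R ^+ d - c%:R) / d%:R)).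
Proof.
have d0 : 0 < d%:R :> rat by rewrite ltr0n; lia.
have d2 : (d < 2 ^ d.-1)%N.
  have : (2 ^ d.-2 <= 2 ^ d.-1)%N by rewrite leq_exp2l //; lia.
  have := @exp2_gt_cubic d ltac:(lia); nia.
have d1 : d.-1.+1 = d by lia.
split=> [|c c1 cd].
  have [H [hH H0 dH cH]] := gadget_eq (leq_trans (isT : 3 <= 50)%N hd) d2.
  (* The bound on the nonempty members of the gadget on [2 * d] vertices; it is twice
     [2 ^ d - d - 1/2], which clears the half. *)
  pose K := (2 ^ d.+1 - 2 * d - 1)%N.
  have cU : #|{: bool * 'I_d}| = (2 * d)%N by rewrite card_prod card_bool card_ord.
  have K2 : (2 * d + 1 <= 2 ^ d.+1)%N.
    have : (2 ^ d.-1 <= 2 ^ d)%N by rewrite leq_exp2l //; lia.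
    rewrite expnS; lia.
  have KR : K%:R = 2%:R * (2 ^+ d - d%:R - 2%:R^-1) :> rat.
    have : (K + (2 * d + 1) = 2 * 2 ^ d)%N by rewrite -expnS /K; lia.
    move/(congr1 (fun n => n%:R : rat)); rewrite /= natrD (natrM _ 2 (2 ^ d)) natrX.
    rewrite (natrD _ _ 1) natrM; lra.
  have -> : (2%:R ^+ d - d%:R - 1 / 2%:R) / d%:R = K%:R / (2 * d)%N%:R :> rat.
    by rewrite KR natrM -mulf_div divff ?mul1r // pnatr_eq0.
  apply: ms_of_bounds => [|n Dn|n m Dn mK]; first by lia.
    have := mns_le_gadget hH H0 dH (n := n); rewrite cU Dn andbT => /(_ _)/leq_trans -> //.
      by lia.
    by rewrite leq_mul2l /K; apply/orP; right; lia.
  (* Here [r = d - 1], the boundary case in which [half_if] contributes the [1/2]. *)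
  have := @mns_ge_tau d d.-1 n m hd; rewrite d1 eqxx; apply; [lia|lia|].
  move: mK; rewrite -(ler_nat rat) !natrM KR => mK.
  rewrite mulrAC ler_pdivlMr // /half_if.
  have : d.-1%:R + 1 = d%:R :> rat by rewrite natr1 d1.
  by move=> e; nra.
have [H [hH H0 dH cH]] := gadget_lt (leq_trans (isT : 3 <= 50)%N hd) (c := c) ltac:(lia) ltac:(lia).
pose K := (2 ^ d - c)%N.
have KR : K%:R = 2 ^+ d - c%:R :> rat.
  rewrite /K natrB ?natrX //.
  have : (2 ^ d.-1 <= 2 ^ d)%N by rewrite leq_exp2l //; lia.
  lia.
rewrite -KR; apply: ms_of_bounds => [|n Dn|n m Dn mK]; first by lia.
  have := mns_le_gadget hH H0 dH (n := n); rewrite card_ord Dn andbT => /(_ _)/leq_trans -> //.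
    by lia.
  by rewrite leq_mul2l /K; apply/orP; right; lia.
have := @mns_ge_tau d c.-1 n m hd; rewrite prednK //; apply; [lia|lia|].
move: mK; rewrite -(ler_nat rat) !natrM KR => mK.
rewrite mulrAC ler_pdivlMr // ltn_eqF; last by lia.
have : c.-1%:R + 1 = c%:R :> rat by rewrite natr1 prednK.
by rewrite /half_if => e; nra.
Qed.
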